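(* Let $X_{n,j}$ be the number of $j$-visits of the $x$-axis in a uniformly random bridge of length $2n$, and let $\lambda_{n,j}=\frac{2\sqrt2\,\binom{2(j-1)}{j-1}\sqrt{n}}{j\,4^{j}}$. Then for $n\to\infty$ and $1\le j=j(n)\le n$ with $j=o(n)$, for every $s\ge1$, \[ \mathbb{E}\big(X_{n,j}^{\underline{s}}\big)=\lambda_{n,j}^s\,2^{s/2}\,\Gamma\big(\tfrac{s}{2}+1\big)(1+o(1)). \] Let $X$ be Rayleigh distributed with parameter $1$. Then: (i) if $\lambda_{n,j}\to\infty$, $X_{n,j}/\lambda_{n,j}$ converges in distribution, with convergence of all moments, to $X$; (ii) if $\lambda_{n,j}\to\rho\in(0,\infty)$, $X_{n,j}$ converges in distribution, with convergence of all moments, to $Y\sim\mathrm{MPo}(\rho X)$. Moreover, $Y/\rho$ converges in distribution to $X$ as $\rho\to\infty$, with convergence of all moments.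
   Context: A bridge of length $2n$ is a lattice path from $(0,0)$ to $(2n,0)$ with steps $(1,1)$ and $(1,-1)$; there are $\binom{2n}{n}$ of them, random means uniform. A visit of the $x$-axis is a point $(2k,0)$, $1\le k\le n$, on the path; it is a $j$-visit if the previous point of the path on the $x$-axis is $(2(k-j),0)$, i.e. the visit occurs after an excursion (positive or negative) of length $2j$. The Rayleigh distribution with parameter $1$ has density $xe^{-x^2/2}$, $x\ge0$. $x^{\underline{s}}=x(x-1)\cdots(x-s+1)$. For non-negative $X$ and $\rho>0$, $Y\sim\mathrm{MPo}(\rho X)$ means $\mathbb{P}\{Y=\ell\}=\frac{\rho^\ell}{\ell!}\mathbb{E}(X^\ell e^{-\rho X})$. ''Convergence of all moments'' refers to non-negative integer moments. *)

(* Defs.v *)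
From HB Require Import structures.
From mathcomp Require Import all_boot all_order all_algebra.
From mathcomp Require Import all_classical all_reals all_analysis.
Set Implicit Arguments. Unset Strict Implicit. Unset Printing Implicit Defensive.
Import Order.TTheory GRing.Theory Num.Theory.
Import numFieldNormedType.Exports.
Local Open Scope classical_set_scope.
Local Open Scope ring_scope.

(* A step sequence of length 2n: w i = true is an up step (1,1),
   false a down step (1,-1). *)
Definition steps (n : nat) := {ffun 'I_(n.*2) -> bool}.

Definition height (n : nat) (w : steps n) (t : nat) : int :=
  \sum_(i < n.*2 | (i < t)%N) (if w i then 1 else -1).

Definition bridges (n : nat) : {set steps n} :=
  [set w : steps n | height w n.*2 == 0].

(* (2k,0) is a j-visit: it lies on the path (on the x-axis), 1 <= k <= n,
   and the previous point of the path on the x-axis is (2(k-j),0). *)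
Definition jvisit (n j : nat) (w : steps n) (k : nat) : bool :=
  [&& (1 <= k)%N, (k <= n)%N, (j <= k)%N, (1 <= j)%N,
      height w k.*2 == 0, height w (k - j).*2 == 0 &
      [forall t : 'I_(n.*2).+1,
         ((k - j).*2 < t < k.*2)%N ==> (height w t != 0)]].

Definition Xvis (n j : nat) (w : steps n) : nat :=
  #|[set k : 'I_n.+1 | jvisit j w k]|.

Section Real.
Variable R : realType.

Definition Ebridge (n : nat) (f : steps n -> R) : R :=
  (\sum_(w in bridges n) f w) / #|bridges n|%:R.

Definition Pbridge (n : nat) (P : steps n -> bool) : R :=
  Ebridge (fun w => (P w)%:R).

Definition lambda (n j : nat) : R :=
  2 * Num.sqrt 2 * ('C((j.-1).*2, j.-1))%:R * Num.sqrt n%:R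
    / (j%:R * 4 ^+ j).

Definition Gamma (a : R) : R :=
  Rintegral lebesgue_measure `]0, +oo[%classic
    (fun x : R => x `^ (a - 1) * expR (- x)).

Definition rayleigh_pdf (x : R) : R :=
  if 0 <= x then x * expR (- (x ^+ 2) / 2) else 0.

Definition rayleigh_cdf (x : R) : R :=
  Rintegral lebesgue_measure `]-oo, x]%classic rayleigh_pdf.

Definition rayleigh_moment (s : nat) : R :=
  Rintegral lebesgue_measure setT (fun x : R => x ^+ s * rayleigh_pdf x).

Definition mpo_pmf (rho : R) (l : nat) : R :=
  rho ^+ l / (l`!)%:R *
  Rintegral lebesgue_measure setT
    (fun x : R => x ^+ l * expR (- (rho * x)) * rayleigh_pdf x).

Definition rseries (u : nat -> R) : R :=
  limn (fun N => \sum_(l < N) u l).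

Definition mpo_scaled_cdf (rho c x : R) : R :=
  rseries (fun l => if l%:R / c <= x then mpo_pmf rho l else 0).

Definition mpo_scaled_moment (rho c : R) (s : nat) : R :=
  rseries (fun l => (l%:R / c) ^+ s * mpo_pmf rho l).

Definition cvg_distr {I : Type} (F0 : set_system I) (Fn : I -> R -> R)
    (F : R -> R) : Prop :=
  forall x : R, {for x, continuous F} -> (fun i => Fn i x) @ F0 --> F x.

End Real.

(* Main.v *)
Require Import Defs.
From HB Require Import structures.
From mathcomp Require Import all_boot all_order all_algebra.
From mathcomp Require Import all_classical all_reals all_analysis.
From mathcomp Require Import measurable_realfun.
From mathcomp Require Import ring lra zify.
Import Order.TTheory GRing.Theory Num.Theory.
Import numFieldNormedType.Exports.
Local Open Scope classical_set_scope.
Local Open Scope ring_scope.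

(* Cutting a bridge at its first return to the axis gives a renewal equation for the binomial
   moments of the number of j-visits, whose solution is
     E X^_s = s! f_j^s [z^(n - s j)] (1 - 4 z)^(- (s + 1) / 2) / C(2 n, n),
   where f_j counts the excursions of length 2 j.  All the generating functions are powers of
   1 - 4 z, so only the Vandermonde convolution of their coefficients is needed.

   The Rayleigh moments mu_s satisfy mu_0 = 1, mu_(s+2) = (s + 2) mu_s and are log-convex; these
   properties determine the sequence and contain Wallis' formula, which yields
   E X^_s / lambda^s --> mu_s.  They also hold for 2^(s/2) Gamma(s/2 + 1), whence the equality
   of the two.

   Factorial moments give P(X = l) through the Bonferroni inequalities, and power moments give
   E (x^l e^(- N x)) through Taylor's inequalities for the exponential; the limits of both
   alternating sums are the analogous expansions for the (mixed Poisson) Rayleigh law.  The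
   Poisson kernel q_N(x, t) = P(Po(N x) <= N t) is within x / (N d^2) of the indicator of x <= t
   up to a shift d of t (Chebyshev), which turns the convergence of E q_N into convergence in
   distribution, both for X / lambda and for Y / rho. *)

(** * Coefficients of the powers of 1 - 4 z *)

(** The normalisation of lambda hides a cancellation: lambda = sqrt(2 n) f_j / 4^j, so the powers of
    f_j disappear from E X^_s / lambda^s, and j survives only in the index n - s j. Since j = o(n),
    this index is asymptotic to n, and a single limit covers bounded and unbounded j.

    Both alternating expansions are cut at a fixed order K, with an error of at most the first
    omitted term. The limit in n thus concerns finitely many moments and precedes the limit in K.
    The error then vanishes for every rho because mu_s grows only about as fast as the square root
    of s!.

    The quantities E (x^l e^(- N x)) are, up to sign, derivatives of the Laplace transform at N, and
    E q_N is a finite combination of them: this is the classical inversion formula for Laplace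
    transforms. For the Rayleigh law E q_N(X, t) is moreover the distribution function of Y / N at
    t, which is why one kernel serves both limits. *)

Section Binom.
Variable R : realType.

(* The coefficient of z^m in (1 - 4 z)^(- a / 2). *)
Fixpoint bcoef (a : R) (m : nat) : R :=
  if m is k.+1 then (4 * k%:R + 2 * a) / k.+1%:R * bcoef a k else 1.

Lemma bcoef0 a : bcoef a 0 = 1. Proof. by []. Qed.

Lemma bcoefS a m : m.+1%:R * bcoef a m.+1 = (4 * m%:R + 2 * a) * bcoef a m.
Proof. by rewrite /=; field; rewrite addrC natr1 pnatr_eq0. Qed.

Definition bconv (f g : nat -> R) m := \sum_(i < m.+1) f i * g (m - i)%N.

Lemma bcoef_conv a b m :
  bconv (bcoef a) (bcoef b) m = bcoef (a + b) m.
Proof.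
elim: m => [|m IH].
  by rewrite /bconv big_ord_recl big_ord0 /= mulr1 addr0.
have m0 : m.+1%:R != 0 :> R by rewrite pnatr_eq0.
apply: (mulfI m0); rewrite bcoefS -IH /bconv.
rewrite mulr_sumr.
(* Leibniz rule: the factor [m.+1] is split as [i + (m.+1 - i)], and [bcoefS] is applied to one of
   the two coefficients in each part. *)
transitivity (\sum_(i < m.+2) (i%:R * bcoef a i * bcoef b (m.+1 - i)%N +
     bcoef a i * ((m.+1 - i)%N%:R * bcoef b (m.+1 - i)%N))).
  apply: eq_bigr => i _; rewrite natrB; last by rewrite -ltnS.
  by ring.
rewrite big_split /= big_ord_recl /= mul0r mul0r add0r.
rewrite [X in _ + X]big_ord_recr /= subnn mul0r mulr0 addr0 -big_split mulr_sumr.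
apply: eq_bigr => i _.
rewrite /bump /= add1n.
rewrite (bcoefS a i) subSS subSn; last by rewrite -ltnS.
rewrite (bcoefS b (m - i)) natrB; last by rewrite -ltnS.
by ring.
Qed.

Lemma bcoef_gt0 a m : 0 < a -> 0 < bcoef a m.
Proof.
move=> a0; elim: m => [|m IH] //=.
rewrite mulr_gt0// divr_gt0 ?ltr0n//.
by rewrite ltr_wpDl ?mulr_gt0// mulr_ge0.
Qed.

Lemma bcoef0S m : bcoef 0 m.+1 = 0.
Proof.
elim: m => [|m IH]; first by rewrite /= !mulr0 addr0 !mul0r.
have m1 : m.+2%:R != 0 :> R by rewrite pnatr_eq0.
by apply: (mulfI m1); rewrite bcoefS IH !mulr0.
Qed.

Lemma central_binS m : (m.+1 * 'C(m.+1.*2, m.+1) = (4 * m + 2) * 'C(m.*2, m))%N.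
Proof.
rewrite doubleS -(mul_bin_diag m.*2.+2 m) /=.
have := mul_bin_down m.*2.+1 m; rewrite /= => H2.
have -> : (m.*2.+2 * 'C(m.*2.+1, m) = 2 * ((m.*2.+1 - m) * 'C(m.*2.+1, m)))%N.
  have -> : (m.*2.+1 - m = m.+1)%N by rewrite -addnn; lia.
  by rewrite mulnA; congr (_ * _)%N; rewrite -addnn; lia.
by rewrite -H2 mulnA; congr (_ * _)%N; rewrite -addnn; lia.
Qed.

Lemma bcoef1E m : bcoef 1 m = 'C(m.*2, m)%:R.
Proof.
elim: m => [|m IH]; first by rewrite bin0.
have m0 : m.+1%:R != 0 :> R by rewrite pnatr_eq0.
apply: (mulfI m0); rewrite bcoefS IH -[RHS]natrM central_binS.
by rewrite natrM natrD natrM mulr1.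
Qed.

(** The series 1 - (1 - 4 z)^(1/2) is 2 z times the Catalan series; the factor 2 will count the two
    signs of an excursion. *)
Lemma bcoefN1E m : - bcoef (-1) m.+1 = 2 * 'C(m.*2, m)%:R / m.+1%:R.
Proof.
elim: m => [|m IH]; first by rewrite /= bin0; field.
have m1 : m.+2%:R != 0 :> R by rewrite pnatr_eq0.
have m0 : m.+1%:R != 0 :> R by rewrite pnatr_eq0.
apply: (mulfI m1); rewrite mulrN bcoefS -mulrN IH.
have : m.+1%:R * 'C(m.+1.*2, m.+1)%:R = (4 * m%:R + 2) * 'C(m.*2, m)%:R :> R.
  by rewrite -natrM central_binS natrM natrD natrM.
move=> /(canRL (mulKf m0)) ->.
rewrite -!natr1 in m0 m1 *; by field; rewrite m0 m1.
Qed.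

End Binom.

(** * Renewal structure of bridges *)

Section Renewal.

(* [z k] tells whether the path is on the axis at time [2 k]. *)
Definition rvisit (j : nat) (z : nat -> bool) (k : nat) : bool :=
  [&& (1 <= k)%N, (j <= k)%N, (1 <= j)%N, z k, z (k - j)%N &
      all (fun l => (k - j < l)%N ==> ~~ z l) (iota 0 k)].

Definition rcount (n j : nat) (z : nat -> bool) : nat :=
  (\sum_(0 <= k < n.+1) rvisit j z k)%N.

Definition first_return (i : nat) (z : nat -> bool) : bool :=
  [&& (1 <= i)%N, z i & all (fun l => ~~ z l) (iota 1 i.-1)].

Lemma first_return_neq i z l : first_return i z -> (0 < l < i)%N -> z l = false.
Proof.
move=> /and3P[i0 _ /allP H] /andP[l0 li].
by apply/negbTE/H; rewrite mem_iota; lia.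
Qed.

(** The axis point preceding the first return is the origin, so the excursion ending there has
    half-length [i]. *)
Lemma rvisit_first_return i j (z : nat -> bool) : z 0%N -> (1 <= j)%N ->
  first_return i z -> rvisit j z i = (i == j).
Proof.
move=> z0 j1 fr; have /and3P[i1 zi _] := fr.
rewrite /rvisit i1 j1 zi /=.
have [ij|ij|ij] := ltngtP i j; first by [].
- by rewrite (first_return_neq _ _ _ fr) //; lia.
rewrite -ij subnn z0 /=; apply/allP => l; rewrite mem_iota => /andP[_ lj].
apply/implyP => l0; rewrite (first_return_neq _ _ _ fr)//.
by rewrite l0 /=; lia.
Qed.

(** An excursion ending after time [i] cannot start before [i], since [i] itself lies on the axis;
    so the path shifted by [i] sees all of it. *)
Lemma rvisit_shift i j k (z : nat -> bool) : (1 <= k)%N ->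
  first_return i z -> rvisit j z (i + k) = rvisit j (fun l => z (i + l)%N) k.
Proof.
move=> k1 fr; have /and3P[i1 zi _] := fr.
rewrite /rvisit k1 (_ : (0 < i + k)%N = true) /=; last by lia.
have [jk|kj] := leqP j k; last first.
  apply/negP => /and5P[jik j1 zik zd /allP H].
  (* An excursion that started before [i] would start at 0, with [i] in its interior, or strictly
     between 0 and [i], where the path is off the axis. *)
  have [d0|d0] := posnP (i + k - j)%N.
    have := H i; rewrite mem_iota d0 i1 /= zi => /(_ _)/negP; apply=> //.
    by lia.
  by move: zd; rewrite (first_return_neq _ _ _ fr) //; lia.
rewrite (_ : (j <= i + k)%N = true) /=; last by lia.
congr [&& _, _, _ & _]; first by rewrite addnBA.
apply/allP/allP => H l; rewrite mem_iota => lk.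
  apply/implyP => kl; apply: (implyP (H (i + l)%N _)); first by rewrite mem_iota; lia.
  by lia.
apply/implyP => kl; have := H (l - i)%N; rewrite subnKC; last by lia.
move=> /(_ _)/implyP; apply; first by rewrite mem_iota; lia.
by lia.
Qed.

Lemma rcount_first_return n i j (z : nat -> bool) : z 0%N -> (1 <= j)%N ->
  (i <= n)%N -> first_return i z ->
  rcount n j z = ((i == j) + rcount (n - i) j (fun l => z (i + l)))%N.
Proof.
move=> z0 j1 lin fr; have /and3P[i1 zi _] := fr.
rewrite /rcount (@big_cat_nat _ _ _ i) //=; last by lia.
rewrite big_nat big1 ?add0n; last first.
  move=> k /andP[_ ki]; rewrite /rvisit; have [->//|k0] := posnP k.
  by rewrite (first_return_neq _ _ _ fr) ?k0// !andbF.
rewrite big_ltn; last by lia.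
rewrite rvisit_first_return//; congr (_ + _)%N.
rewrite [RHS]big_ltn// add0n.
rewrite -{1}(add0n i) -addSn big_addn subSn//.
rewrite [LHS]big_nat [RHS]big_nat; apply: eq_bigr => k /andP[k1 _].
by rewrite addnC rvisit_shift.
Qed.

Lemma exists_first_return n (z : nat -> bool) : (1 <= n)%N -> z n ->
  exists2 i, (1 <= i <= n)%N & first_return i z.
Proof.
move=> n1 zn.
have ex : exists i, (1 <= i)%N && z i by exists n; rewrite n1.
case: (ex_minnP ex) => i /andP[i1 zi] H; exists i.
  by rewrite i1 H // n1.
rewrite /first_return i1 zi; apply/allP => l; rewrite mem_iota => li.
by apply/negP => zl; have := H l; rewrite zl; lia.
Qed.

Lemma first_return_uniq i i' z : first_return i z -> first_return i' z -> i = i'.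
Proof.
move=> fr fr'; have /and3P[i1 zi _] := fr; have /and3P[i1' zi' _] := fr'.
have [ii|ii|//] := ltngtP i i'.
  by move: zi; rewrite (first_return_neq _ _ _ fr') // i1.
by move: zi'; rewrite (first_return_neq _ _ _ fr) // i1'.
Qed.

(** Existence and uniqueness of the first return as a partition of unity, ready to be inserted as a
    factor under a sum over words. *)
Lemma sum_first_return (R : pzSemiRingType) n (z : nat -> bool) : (1 <= n)%N -> z n ->
  \sum_(1 <= i < n.+1) (first_return i z)%:R = 1 :> R.
Proof.
move=> n1 zn; have [i /andP[i1 lin] fr] := exists_first_return n z n1 zn.
rewrite (@big_cat_nat _ _ _ i) //=; last by lia.
rewrite big_nat big1 ?add0r; last first.
  move=> k /andP[_ ki]; case: (boolP (first_return k z)) => // frk.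
  by move: ki; rewrite (first_return_uniq _ _ _ frk fr) ltnn.
rewrite big_ltn; last by lia.
rewrite fr big_nat big1 ?addr0// => k /andP[ki _].
case: (boolP (first_return k z)) => // frk.
by move: ki; rewrite (first_return_uniq _ _ _ frk fr) ltnn.
Qed.

Lemma eq_first_return i (z z' : nat -> bool) :
  (forall l, (l <= i)%N -> z l = z' l) -> first_return i z = first_return i z'.
Proof.
move=> H; rewrite /first_return; have [->//|i0] := posnP i.
rewrite H //; congr [&& _, _ & _]; apply: eq_in_all => l.
by rewrite mem_iota => li; rewrite H //; lia.
Qed.

End Renewal.

(** * Words of up and down steps, and sums over all words of a given length *)

Section Words.
Variable R : realType.

Definition sgn (b : bool) : int := if b then 1 else -1.

Definition word_height (w : seq bool) (t : nat) : int :=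
  \sum_(0 <= i < t) sgn (nth false w i).

Definition word_zero (w : seq bool) (l : nat) : bool := word_height w l.*2 == 0.

Lemma word_height_catl u v t : (t <= size u)%N -> word_height (u ++ v) t = word_height u t.
Proof.
move=> tu; rewrite /word_height !big_nat; apply: eq_bigr => i /andP[_ it].
by rewrite nth_cat ifT //; lia.
Qed.

Lemma word_height_catr u v t : word_height (u ++ v) (size u + t) = word_height u (size u) + word_height v t.
Proof.
rewrite -(word_height_catl u v) // /word_height (@big_cat_nat _ _ _ (size u)) //=; last by lia.
congr (_ + _); rewrite -{1}(add0n (size u)) big_addn addKn.
by apply: eq_bigr => i _; rewrite nth_cat ifF ?addnK//; lia.
Qed.

(** The height is twice the number of up steps minus [t]. Hence [rvisit], which only looks at even
    times, misses no point of the axis. *)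
Lemma word_height_odd w t : odd t -> word_height w t != 0.
Proof.
move=> ot; suff [c ->] : exists c : int, word_height w t = c *+ 2 - t%:Z by apply/eqP; lia.
elim: t {ot} => [|t [c IH]]; first by exists 0; rewrite /word_height big_geq.
rewrite /word_height big_nat_recr //= -/(word_height w t) IH; case: nth; rewrite /sgn.
  by exists (c + 1); lia.
by exists c; lia.
Qed.

Lemma word_height_size w : word_height w (size w) = (count id w).*2%:Z - (size w)%:Z.
Proof.
elim: w => [|b w IH]; first by rewrite /word_height big_geq.
rewrite -cat1s size_cat word_height_catr IH {1}/word_height /= big_nat1 /= /sgn.
by case: b => /=; lia.
Qed.

Lemma word_zero_catl u v l : (l.*2 <= size u)%N -> word_zero (u ++ v) l = word_zero u l.
Proof. by move=> lu; rewrite /word_zero word_height_catl. Qed.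

Lemma word_zero_catr u v i l : size u = i.*2 -> word_zero u i -> word_zero (u ++ v) (i + l) = word_zero v l.
Proof.
move=> su zu; rewrite /word_zero doubleD -su word_height_catr su.
by move: zu; rewrite /word_zero => /eqP ->; rewrite add0r.
Qed.

(** The length is only a recursion index and the summand takes plain sequences, so that cutting all
    words at a given position ([wsum_cat]) involves no casts. *)
Fixpoint wsum (L : nat) (F : seq bool -> R) : R :=
  if L is L'.+1 then wsum L' (F \o cons true) + wsum L' (F \o cons false)
  else F [::].

Lemma eq_wsum L F G : (forall w, size w = L -> F w = G w) -> wsum L F = wsum L G.
Proof.
elim: L F G => [|L IH] F G FG /=; first exact: FG.
by congr (_ + _); apply: IH => w sw; apply: FG; rewrite /= sw.
Qed.

Lemma wsumD L F G : wsum L (fun w => F w + G w) = wsum L F + wsum L G.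
Proof.
elim: L F G => [|L IH] F G //=.
by rewrite addrACA -(IH (F \o cons true)) -(IH (F \o cons false)).
Qed.

Lemma wsumZ L c F : wsum L (fun w => c * F w) = c * wsum L F.
Proof.
elim: L F => [|L IH] F //=.
by rewrite mulrDr -(IH (F \o cons true)) -(IH (F \o cons false)).
Qed.

Lemma wsumZr L c F : wsum L (fun w => F w * c) = wsum L F * c.
Proof.
elim: L F => [|L IH] F //=.
by rewrite mulrDl -(IH (F \o cons true)) -(IH (F \o cons false)).
Qed.

Lemma wsum_sum L (r : seq nat) (F : nat -> seq bool -> R) :
  wsum L (fun w => \sum_(i <- r) F i w) = \sum_(i <- r) wsum L (F i).
Proof.
elim: r => [|i r IH].
  rewrite big_nil -[RHS](mul0r (wsum L (fun=> 0))) -wsumZ.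
  by apply: eq_wsum => w _; rewrite big_nil mul0r.
rewrite big_cons -IH -wsumD; apply: eq_wsum => w _.
by rewrite big_cons.
Qed.

Lemma wsum_cat a b F :
  wsum (a + b) F = wsum a (fun u => wsum b (fun v => F (u ++ v))).
Proof. by elim: a F => [|a IH] F //=; rewrite !IH. Qed.

Lemma wsum_count L k : wsum L (fun w => (count id w == k)%:R) = 'C(L, k)%:R.
Proof.
elim: L k => [|L IH] k; first by rewrite /= bin0n eq_sym.
rewrite /= -[X in X + _]/(wsum L (fun w => (1 + count id w == k)%N%:R)).
rewrite -[X in _ + X]/(wsum L (fun w => (count id w == k)%:R)) IH.
case: k => [|k]; last by rewrite binS natrD addrC; congr (_ + _); exact: IH.
rewrite !bin0 -[X in _ = X]add0r; congr (_ + _).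
by rewrite -[RHS](mul0r (wsum L (fun=> 0))) -wsumZ; apply: eq_wsum => w _; rewrite mul0r.
Qed.

Lemma wsum_tuple L F : \sum_(t : L.-tuple bool) F (val t) = wsum L F.
Proof.
elim: L F => [|L IH] F /=.
  rewrite (big_pred1 [tuple of [::]]) // => t /=.
  by apply/esym/eqP; rewrite (tuple0 t); apply: val_inj.
rewrite -!IH -(big_bool _ (fun b => \sum_(t : L.-tuple bool) F (b :: t))) pair_big /=.
rewrite (reindex (fun p : bool * L.-tuple bool => [tuple of p.1 :: p.2])) //=.
exists (fun t : L.+1.-tuple bool => (thead t, [tuple of behead t])) => [[b t] _|t _] /=.
  by congr pair; apply: val_inj.
by rewrite [RHS]tuple_eta; apply: val_inj.
Qed.

Lemma wsum_ffun L (F : {ffun 'I_L -> bool} -> R) (G : seq bool -> R) :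
  (forall t : L.-tuple bool, F [ffun i => tnth t i] = G t) ->
  \sum_(w : {ffun 'I_L -> bool}) F w = wsum L G.
Proof.
move=> FG; rewrite -wsum_tuple.
rewrite (reindex (fun t : L.-tuple bool => [ffun i => tnth t i])) /=.
  by apply: eq_bigr => t _; exact: FG.
exists (fun w : {ffun 'I_L -> bool} => [tuple w i | i < L]) => [t _|w _].
  by apply: eq_from_tnth => i; rewrite tnth_mktuple ffunE.
by apply/ffunP => i; rewrite ffunE tnth_mktuple.
Qed.

End Words.

(** * Renewal equation for the binomial moments and its solution *)

Section Count.
Variable R : realType.
Local Arguments bcoef : simpl never.

Let zpos (w : seq bool) : word_zero w 0 . Proof. by rewrite /word_zero /word_height big_geq. Qed.

(** Binomial coefficients rather than falling factorials, because Pascal's rule absorbs the extra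
    visit that a first excursion of length [2 j] contributes. *)
Definition bmoment (j s n : nat) : R :=
  wsum R n.*2 (fun w => (word_zero w n)%:R * 'C(rcount n j (word_zero w), s)%:R).

Definition nfirst (i : nat) : R := wsum R i.*2 (fun w => (first_return i (word_zero w))%:R).

(** The function [F] is left general: [F = 1] will count first returns, and binomial coefficients
    will give the moments. *)
Lemma bmoment_rec_aux (j n : nat) (F : nat -> R) : (1 <= j)%N -> (1 <= n)%N ->
  wsum R n.*2 (fun w => (word_zero w n)%:R * F (rcount n j (word_zero w))) =
  \sum_(1 <= i < n.+1) nfirst i * wsum R (n - i).*2
     (fun v => (word_zero v (n - i))%:R * F ((i == j) + rcount (n - i) j (word_zero v))%N).
Proof.
move=> j1 n1.
transitivity (wsum R n.*2 (fun w => \sum_(1 <= i < n.+1)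
   (first_return i (word_zero w))%:R * ((word_zero w n)%:R * F (rcount n j (word_zero w))))).
  apply: eq_wsum => w _; rewrite -mulr_suml; case: (boolP (word_zero w n)) => zn.
    by rewrite sum_first_return // mul1r.
  by rewrite !mul0r mulr0.
rewrite wsum_sum !big_nat; apply: eq_bigr => i /andP[i1 lin].
have -> : n.*2 = (i.*2 + (n - i).*2)%N by rewrite -doubleD; lia.
rewrite wsum_cat /nfirst -wsumZr; apply: eq_wsum => u su.
rewrite -wsumZ; apply: eq_wsum => v sv.
have fru : first_return i (word_zero (u ++ v)) = first_return i (word_zero u).
  by apply: eq_first_return => l li; rewrite word_zero_catl// su leq_double.
have [fr|] := boolP (first_return i (word_zero u)); last by rewrite fru => /negbTE ->; rewrite !mul0r.
rewrite fru fr !mul1r.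
have zsi : word_zero u i by case/and3P: fr.
have zc l : word_zero (u ++ v) (i + l) = word_zero v l by rewrite (word_zero_catr _ _ _ _ su zsi).
rewrite (rcount_first_return n i j) ?fru//.
have -> : word_zero (u ++ v) n = word_zero v (n - i) by rewrite -zc subnKC.
by congr (_ * F (_ + _)%N); congr rcount; apply/funext => l; rewrite zc.
Qed.

Lemma wsum_word_zero n : wsum R n.*2 (fun w => (word_zero w n)%:R) = bcoef R 1 n.
Proof.
rewrite bcoef1E -wsum_count; apply: eq_wsum => w sw.
rewrite /word_zero -{1}sw word_height_size sw; congr (_%:R : R); congr nat_of_bool.
by apply/eqP/eqP; rewrite -!muln2; lia.
Qed.

(** With N the series of first returns and B = (1 - 4 z)^(-1/2) that of bridges, the renewal
    equation for [F = 1] reads B = 1 + N B, so N = 1 - (1 - 4 z)^(1/2). In each degree only the last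
    term of the convolution is new, hence the strong induction. *)
Lemma nfirstE i : nfirst i.+1 = - bcoef R (-1) i.+1.
Proof.
have cnt := wsum_word_zero.
have [n] := ubnP i; elim: n i => // n IH i; rewrite ltnS => lin.
have := bmoment_rec_aux 1 i.+1 (fun=> 1) isT isT.
under eq_wsum do rewrite mulr1; rewrite cnt => H.
have {}H : bcoef R 1 i.+1 = \sum_(1 <= k < i.+2) nfirst k * bcoef R 1 (i.+1 - k).
  rewrite H; apply: eq_bigr => k _; congr (_ * _); rewrite -cnt.
  by apply: eq_wsum => w _; rewrite mulr1.
have := bcoef_conv R (-1) 1 i.+1; rewrite addNr bcoef0S /bconv.
rewrite -(big_mkord xpredT (fun k => bcoef R (-1) k * bcoef R 1 (i.+1 - k))).
rewrite big_nat_recl // bcoef0 mul1r subn0 H.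
rewrite big_add1 /= big_nat_recr //= [X in _ + X]big_nat_recr //=.
rewrite (_ : \sum_(0 <= k < i) nfirst k.+1 * _ = - \sum_(0 <= k < i) bcoef R (-1) k.+1 * bcoef R 1 (i.+1 - k.+1)).
  rewrite subnn bcoef0 !mulr1; lra.
rewrite -sumrN !big_nat; apply: eq_bigr => k /andP[_ ki].
by rewrite IH ?mulNr//; lia.
Qed.

Lemma bmoment_rec j s n : (1 <= j)%N -> (1 <= n)%N ->
  bmoment j s.+1 n = \sum_(1 <= i < n.+1) nfirst i * bmoment j s.+1 (n - i)
     + (if (j <= n)%N then nfirst j * bmoment j s (n - j) else 0).
Proof.
move=> j1 n1; rewrite /bmoment (bmoment_rec_aux j n (fun x => 'C(x, s.+1)%:R)) //.
transitivity (\sum_(1 <= i < n.+1) (nfirst i * bmoment j s.+1 (n - i) +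
   (if i == j then nfirst i * bmoment j s (n - i) else 0))).
  apply: eq_bigr => i _; have [->|ij] := eqVneq i j; last by rewrite addr0.
  rewrite -mulrDr /bmoment -wsumD; congr (_ * _); apply: eq_wsum => v _.
  by rewrite -mulrDr add1n binS natrD.
rewrite big_split /=; congr (_ + _).
case: leqP => jn.
  rewrite (@big_cat_nat _ _ _ j) //=; last by lia.
  rewrite big_nat big1 ?add0r; last by move=> k /andP[_ kj]; rewrite ltn_eqF.
  rewrite big_ltn; last by lia.
  rewrite eqxx big_nat big1 ?addr0// => k /andP[jk _].
  by rewrite gtn_eqF.
rewrite big_nat big1 // => k /andP[_ kn].
by rewrite ltn_eqF//; lia.
Qed.

(** For the generating functions G_s, [bmoment_rec] says (1 - N) G_(s+1) = f_j z^j G_s with 1 - N =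
    (1 - 4 z)^(1/2), so each step in [s] contributes a factor f_j z^j (1 - 4 z)^(-1/2). The closed
    form is checked by induction on [s], then on [n]. *)
Lemma bmomentE j s n : (1 <= j)%N ->
  bmoment j s n = if (s * j <= n)%N then nfirst j ^+ s * bcoef R s.+1%:R (n - s * j) else 0.
Proof.
move=> j1; elim: s n => [|s IHs] n.
  rewrite mul0n leq0n subn0 expr0 mul1r -wsum_word_zero; apply: eq_wsum => w _.
  by rewrite bin0 mulr1.
have [k] := ubnP n; elim: k n => // k IH n; rewrite ltnS => nk.
have [->|n1] := posnP n.
  rewrite leqNgt muln_gt0 j1 /= /bmoment /= /rcount big_nat1 /rvisit /=.
  by rewrite bin0n mulr0.
rewrite bmoment_rec // IHs.
under eq_big_nat => i /andP[i1 lin].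
  rewrite IH; last by lia.
  over.
have [sjn|sjn] := leqP (s.+1 * j)%N n; last first.
  rewrite big_nat big1 ?add0r; last first.
    by move=> i /andP[i1 _]; rewrite ifF ?mulr0//; lia.
  case: leqP => jn //; rewrite ifF ?mulr0//.
  by move: sjn; rewrite mulSn; lia.
have jn : (j <= n)%N by move: sjn; rewrite mulSn; lia.
rewrite jn ifT; last by move: sjn; rewrite mulSn; lia.
have mE : (n - j - s * j = n - s.+1 * j)%N by rewrite mulSn; lia.
rewrite mE; set m := (n - s.+1 * j)%N.
rewrite (@big_cat_nat _ _ _ m.+1) //=; last by rewrite /m; lia.
rewrite [X in _ + X + _]big_nat [X in _ + X + _]big1 ?addr0; last first.
  by move=> i /andP[mi _]; rewrite ifF ?mulr0//; rewrite /m in mi; lia.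
(* Multiplication by (1 - 4 z)^(1/2) lowers the parameter from [s.+2] to [s.+1], which is the
   previous moment. *)
have := bcoef_conv R (-1) s.+2%:R m; rewrite /bconv.
rewrite -(big_mkord xpredT (fun k => bcoef R (-1) k * bcoef R s.+2%:R (m - k))).
rewrite big_ltn // bcoef0 mul1r subn0.
rewrite (_ : -1 + s.+2%:R = s.+1%:R :> R); last by rewrite -natr1; ring.
move=> <-; rewrite mulrA -exprS mulrDr addrCA -[RHS]addr0; congr (_ + _).
rewrite mulr_sumr -big_split /= big_nat big1 // => i /andP[i1 im].
rewrite ifT; last by rewrite /m in im; lia.
rewrite (_ : (n - i - s.+1 * j = m - i)%N); last by rewrite /m; lia.
case: i i1 im => // i _ _; rewrite nfirstE; ring.
Qed.

End Count.

(** * Transfer from words to the bridges of the statement *)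

Section Bridges.
Variable R : realType.

Definition word_of (n : nat) (t : n.*2.-tuple bool) : steps n := [ffun i => tnth t i].

Lemma height_word_of n (t : n.*2.-tuple bool) k : (k <= n.*2)%N ->
  height (word_of n t) k = word_height t k.
Proof.
move=> kn; rewrite /height /word_height big_mkord (big_ord_widen n.*2 (fun i => sgn (nth false t i)) kn).
by apply: eq_bigr => i _; rewrite ffunE (tnth_nth false).
Qed.

Lemma jvisit_word_of n j (t : n.*2.-tuple bool) k : (k <= n)%N ->
  jvisit j (word_of n t) k = rvisit j (word_zero t) k.
Proof.
move=> kn; rewrite /jvisit /rvisit kn /=.
have [k1|//] := ltnP 0 k; have [jk|//] := leqP j k; have [j1|//] := ltnP 0 j.
rewrite /= !height_word_of; [|lia|lia].
rewrite -/(word_zero t k) -/(word_zero t (k - j)); congr [&& _, _ & _].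
apply/forallP/allP => H l.
  rewrite mem_iota => lk; apply/implyP => kl.
  have l2 : (l.*2 < n.*2.+1)%N by lia.
  have := H (Ordinal l2); rewrite /= height_word_of; last by lia.
  by move=> /implyP; apply; lia.
apply/implyP => lk; rewrite height_word_of; last by rewrite -ltnS.
(* [jvisit] ranges over all times inside the excursion: parity settles the odd ones, [rvisit] the
   even ones. *)
have [ol|el] := boolP (odd l); first exact: word_height_odd.
have lE : (nat_of_ord l) = l./2.*2 by rewrite -[LHS]odd_double_half (negbTE el).
rewrite lE; have := H l./2; rewrite mem_iota => /(_ _)/implyP; apply; lia.
Qed.

(* [Xvis] is the cardinal of a classical set, whose membership is a reflected proposition. *)
Lemma Xvis_word_of n j (t : n.*2.-tuple bool) :
  Xvis j (word_of n t) = rcount n j (word_zero t).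
Proof.
rewrite /Xvis -sum1_card /rcount big_mkord [LHS]big_mkcond /=.
apply: eq_bigr => k _.
rewrite -[k \in _]/(`[< is_true (jvisit j (word_of n t) k) >]) asboolb.
by rewrite jvisit_word_of; [case: rvisit|rewrite -ltnS].
Qed.

Lemma sum_bridges n j (F : nat -> R) :
  \sum_(w in bridges n) F (Xvis j w) =
  wsum R n.*2 (fun w => (word_zero w n)%:R * F (rcount n j (word_zero w))).
Proof.
rewrite big_mkcond /=; apply: wsum_ffun => t /=.
rewrite -/(word_of n t) /bridges finset.in_set height_word_of// -/(word_zero t n) Xvis_word_of.
by case: word_zero; rewrite ?mul1r ?mul0r.
Qed.

Lemma card_bridges n : #|bridges n|%:R = bcoef R 1 n.
Proof.
rewrite -sum1_card natr_sum (sum_bridges n 1 (fun=> 1)) -wsum_word_zero.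
by apply: eq_wsum => w _; rewrite mulr1.
Qed.

Lemma Ebridge_ffact n j s : (1 <= j)%N -> (s * j <= n)%N ->
  Ebridge (fun w : steps n => ((Xvis j w) ^_ s)%:R : R) =
  s`!%:R * nfirst R j ^+ s * bcoef R s.+1%:R (n - s * j) / bcoef R 1 n.
Proof.
move=> j1 sjn; rewrite /Ebridge card_bridges; congr (_ / _).
rewrite (sum_bridges n j (fun x => (x ^_ s)%:R)) -mulrA.
have -> : nfirst R j ^+ s * bcoef R s.+1%:R (n - s * j) = bmoment R j s n.
  by rewrite bmomentE// sjn.
rewrite /bmoment -wsumZ; apply: eq_wsum => w _.
by rewrite mulrCA -bin_ffact natrM (mulrC 'C(_, _)%:R).
Qed.

Lemma lambdaE n j : (1 <= j)%N ->
  lambda R n j = Num.sqrt 2 * Num.sqrt n%:R * (nfirst R j / 4 ^+ j).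
Proof.
case: j => // j _; rewrite nfirstE bcoefN1E /lambda /=.
have j0 : j.+1%:R != 0 :> R by rewrite pnatr_eq0.
have e0 : 4 ^+ j.+1 != 0 :> R by rewrite expf_neq0.
by field; rewrite e0 addrC natr1 j0.
Qed.

End Bridges.

(** * Moments of the Rayleigh distribution *)

Section Substitution.
Variables (R : realType) (h h' p : R -> R).
Hypothesis h_cont : continuous h.
Hypothesis p_cont : continuous p.
Hypothesis h0 : h 0 = 0.
Hypothesis h_ge0 : forall x : R, 0 <= x -> 0 <= h x.
Hypothesis p_ge0 : forall x : R, 0 <= x -> 0 <= p x.
Hypothesis h_drv : forall x : R, 0 < x -> is_derive x 1 h (h' x).
Hypothesis hh' : forall x : R, 0 < x -> h x * h' x = p x.
Hypothesis h_oo : h x @[x --> +oo] --> +oo.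
Let mu := @lebesgue_measure R.

(** The substitution y = h x is carried out on antiderivatives: if F' = y f(y), then F o h has
    derivative f(h) h h' = f(h) p. It will be used for h = p = id (Rayleigh density) and for h =
    sqrt(2 x), p = 1 (Gamma integral); the latter h has no derivative at 0, whence the conditions on
    x > 0. *)
Lemma ge0_integral_subst (f F : R -> R) (l : R) :
  continuous f -> (forall y : R, 0 <= y -> 0 <= f y) ->
  (forall y : R, is_derive y 1 F (y * f y)) -> F y @[y --> +oo] --> l ->
  (\int[mu]_(x in `[0%R, +oo[) (f (h x) * p x)%:E = (l - F 0)%:E)%E.
Proof.
move=> cf f0 dF Fl.
have dFh (x : R) : 0 < x -> is_derive x 1 (F \o h) (f (h x) * p x).
  move=> x0; have := h_drv _ x0 => dh.
  have := dF (h x) => dFx.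
  apply: (is_derive_eq (is_derive1_comp dFx dh)).
  by rewrite /GRing.scale /= -(hh' _ x0); ring.
rewrite (@ge0_continuous_FTC2y _ _ (F \o h) 0 l) //=.
- by rewrite h0.
- by move=> x x0; rewrite mulr_ge0 ?f0 ?h_ge0 ?p_ge0.
- apply: continuous_subspaceT => x; apply: cvgM; last exact: p_cont.
  by apply: continuous_comp; [exact: h_cont|exact: cf].
- exact: cvg_comp h_oo Fl.
- by move=> x x0; have [] := dFh x x0.
- apply: cvg_at_right_filter; apply: continuous_comp; first exact: h_cont.
  by apply: differentiable_continuous; apply/derivable1_diffP; have [] := dF (h 0).
- move=> x; rewrite in_itv/= andbT => x0.
  by rewrite derive1E; apply: derive_val; exact: dFh.
Qed.

Lemma integrable_subst (f F : R -> R) (l : R) :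
  continuous f -> (forall y : R, 0 <= y -> 0 <= f y) ->
  (forall y : R, is_derive y 1 F (y * f y)) -> F y @[y --> +oo] --> l ->
  mu.-integrable `[0%R, +oo[ (EFin \o (fun x => f (h x) * p x)).
Proof.
move=> cf f0 dF Fl; apply/integrableP; split.
  apply/measurable_EFinP; apply: measurable_funTS.
  apply: continuous_measurable_fun => x; apply: cvgM; last exact: p_cont.
  by apply: continuous_comp; [exact: h_cont|exact: cf].
have -> : (\int[mu]_(x in `[0%R, +oo[) `|(EFin \o (fun x => f (h x) * p x)%R) x| = 
    \int[mu]_(x in `[0%R, +oo[) (f (h x) * p x)%:E)%E.
  apply: eq_integral => x /=; rewrite inE/= in_itv/= andbT => x0.
  by rewrite ger0_norm // mulr_ge0 ?f0 ?h_ge0 ?p_ge0.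
by rewrite (ge0_integral_subst _ _ _ cf f0 dF Fl) ltry.
Qed.

End Substitution.

(** Trades a power for half of the Gaussian exponent. What remains, multiplied by y, has an explicit
    antiderivative, so integrability follows by domination. *)
Lemma exprn_gauss_le (R : realType) k : exists2 C : R, 0 <= C &
  forall y : R, `|y| ^+ k * expR (- (y ^+ 2) / 2) <= C * expR (- (y ^+ 2) / 4).
Proof.
have C0 : 0 <= 1 + 4 ^+ k * k`!%:R :> R by rewrite addr_ge0// mulr_ge0// exprn_ge0.
exists (1 + 4 ^+ k * k`!%:R) => // y.
(* The summand 1 of the constant handles |y| <= 1. Beyond, |y|^k <= (y^2)^k, and z^k / k! <= e^z
   with z = y^2 / 4 gives 4^k k!. *)
have z0 : 0 <= y ^+ 2 / 4 by rewrite divr_ge0// sqr_ge0.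
suff H : `|y| ^+ k <= (1 + 4 ^+ k * k`!%:R) * expR (y ^+ 2 / 4).
  apply: (le_trans (ler_wpM2r (expR_ge0 _) H)).
  rewrite -mulrA -expRD; suff -> : y ^+ 2 / 4 + - y ^+ 2 / 2 = - y ^+ 2 / 4 by [].
  by field.
have e1 : 1 <= expR (y ^+ 2 / 4) by apply: le_trans (expR_ge1Dx _); rewrite lerDl.
have zk : (y ^+ 2 / 4) ^+ k / k`!%:R <= expR (y ^+ 2 / 4).
  case: k {C0} => [|k]; first by rewrite expr0 divr1.
  by apply: le_trans (expR_ge1Dxn k z0) => {e1}; rewrite -[leLHS]add0r lerD2r ler01.
have {}zk : (y ^+ 2) ^+ k <= 4 ^+ k * k`!%:R * expR (y ^+ 2 / 4).
  move: zk; rewrite ler_pdivrMr ?ltr0n ?fact_gt0// exprMn exprVn.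
  rewrite ler_pdivrMr ?exprn_gt0// => /le_trans; apply.
  by rewrite le_eqVlt; apply/orP; left; apply/eqP; ring.
rewrite mulrDl mul1r.
have [y1|y1] := leP `|y| 1.
  apply: ler_wpDr; first by rewrite !mulr_ge0 ?expR_ge0 ?exprn_ge0.
  by apply: le_trans e1; rewrite exprn_ile1.
apply: ler_wpDl; first exact: expR_ge0.
apply: le_trans zk; rewrite -real_normK ?num_real// -exprM mulnC.
by rewrite mulnC exprM lerXn2r ?nnegrE// ?exprn_ge0// ler_eXnr// ltW.
Qed.

Lemma gauss4_cvg0 (R : realType) : expR (- (y ^+ 2) / 4) @[y --> +oo%R] --> (0 : R).
Proof.
have H : (fun y : R => expR (- (y ^+ 2) / 4)) = (fun y => gauss_fun y) \o (fun y => 2^-1 * y).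
  by apply/funext => y /=; rewrite /gauss_fun; congr expR; field.
rewrite H; apply: (cvg_comp _ _ _ (@cvg_gauss_fun R)).
by apply: gt0_cvgMry.
Qed.

Lemma exprn_gauss_cvg0 (R : realType) k :
  y ^+ k * expR (- (y ^+ 2) / 2) @[y --> +oo%R] --> (0 : R).
Proof.
have [C C0 HC] := exprn_gauss_le R k.
apply/norm_cvg0P; apply: (@squeeze_cvgr _ _ _ _ (cst 0) (fun y => C * expR (- (y ^+ 2) / 4))).
- by apply: nearW => y /=; rewrite normr_ge0 /= normrM normrX (ger0_norm (expR_ge0 _)) HC.
- exact: cvg_cst.
- by rewrite -(mulr0 C); apply: cvgMl_tmp; exact: gauss4_cvg0.
Qed.

Section LinearCombination.
Context d (T : measurableType d) (R : realType) (mu : {measure set T -> \bar R}).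
Variables (D : set T) (f g : T -> R).
Hypothesis If : mu.-integrable D (EFin \o f).
Hypothesis Ig : mu.-integrable D (EFin \o g).
Hypothesis mD : measurable D.

Lemma integrable_lincomb (a b : R) :
  mu.-integrable D (EFin \o (fun x => a * f x + b * g x)).
Proof.
have := integrableD mD (integrableZl mD a If) (integrableZl mD b Ig).
by apply: eq_integrable.
Qed.

Lemma Rintegral_lincomb (a b : R) :
  \int[mu]_(x in D) (a * f x + b * g x) =
  a * \int[mu]_(x in D) f x + b * \int[mu]_(x in D) g x.
Proof.
rewrite RintegralD //; first by rewrite !RintegralZl.
  exact: (integrableZl mD a If).
exact: (integrableZl mD b Ig).
Qed.

End LinearCombination.
Arguments integrable_lincomb {d T R mu D f g} If Ig mD a b.
Arguments Rintegral_lincomb {d T R mu D f g} If Ig mD a b.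

Lemma is_derive_exprn_gauss (R : realType) (k : nat) (C y : R) :
  is_derive y 1 (fun y => - ((y ^+ k.+2 + C) * expR (- (y ^+ 2) / 2)))
    (y * ((y ^+ k.+2 - k.+2%:R * y ^+ k + C) * expR (- (y ^+ 2) / 2))).
Proof.
have d1 : is_derive y 1 (fun y : R => y ^+ k.+2 + C) (k.+2%:R * y ^+ k.+1).
  have dX : is_derive y 1 (fun y : R => y ^+ k.+2) (k.+2%:R * y ^+ k.+1).
    by split; [exact: exprn_derivable|rewrite exp_derive /GRing.scale /= mulr1].
  apply: (is_derive_eq (is_deriveD dX (is_derive_cst C y (1 : R)))).
  by rewrite addr0.
have d2 : is_derive y 1 (fun y : R => expR (- (y ^+ 2) / 2)) (- y * expR (- (y ^+ 2) / 2)).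
  by apply: is_derive_eq; rewrite /GRing.scale /=; field.
apply: (is_derive_eq (is_deriveN (is_deriveM d1 d2))).
rewrite /GRing.scale /=; move: (expR _) (y ^+ k) (exprS y k) (exprS y k.+1) => e z -> ->.
by move: (k.+2%:R); move=> a; ring.
Qed.

Section Moments.
Variables (R : realType) (h h' p : R -> R).
Hypothesis h_cont : continuous h.
Hypothesis p_cont : continuous p.
Hypothesis h0 : h 0 = 0.
Hypothesis h_ge0 : forall x : R, 0 <= x -> 0 <= h x.
Hypothesis p_ge0 : forall x : R, 0 <= x -> 0 <= p x.
Hypothesis h_drv : forall x : R, 0 < x -> is_derive x 1 h (h' x).
Hypothesis hh' : forall x : R, 0 < x -> h x * h' x = p x.
Hypothesis h_oo : h x @[x --> +oo] --> +oo.
Let mu := @lebesgue_measure R.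

Let D : set R := `[0%R, +oo[.
Let mD : measurable D. Proof. exact: measurable_itv. Qed.

Lemma integrable_gauss4 (C : R) : 0 <= C ->
  mu.-integrable D (EFin \o (fun x => C * expR (- (h x ^+ 2) / 4) * p x)).
Proof.
move=> C0; apply: (@integrable_subst _ h h' p _ _ _ _ _ _ _ _ (fun y => C * expR (- (y ^+ 2) / 4))
    (fun y => - (2 * C) * expR (- (y ^+ 2) / 4)) 0) => //.
- move=> y; apply: cvgMl_tmp.
  apply: continuous_comp; last exact: continuous_expR.
  by apply: cvgMr_tmp; apply: cvgN; exact: exprn_continuous.
- by move=> y _; rewrite mulr_ge0// expR_ge0.
- move=> y; apply: is_derive_eq.
  by rewrite /GRing.scale /=; field.
- by rewrite -(mulr0 (- (2 * C))); apply: cvgMl_tmp; exact: gauss4_cvg0.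
Qed.

(** After y = h x this is the integral of y^(s+1) e^(- y^2 / 2) over y >= 0, whichever pair [h], [p]
    is chosen. *)
Definition gmoment (s : nat) : R :=
  \int[mu]_(x in D) (h x ^+ s * expR (- (h x ^+ 2) / 2) * p x).

Lemma integrable_gmoment s :
  mu.-integrable D (EFin \o (fun x => h x ^+ s * expR (- (h x ^+ 2) / 2) * p x)).
Proof.
have [C C0 HC] := exprn_gauss_le R s.
apply: le_integrable (integrable_gauss4 C C0) => //.
- apply/measurable_EFinP; apply: measurable_funTS.
  apply: continuous_measurable_fun => x; apply: cvgM; last exact: p_cont.
  apply: cvgM.
    by apply: (@continuous_comp _ _ _ h (fun y => y ^+ s)); [exact: h_cont|exact: exprn_continuous].
  apply: (@continuous_comp _ _ _ (fun x => - (h x ^+ 2) / 2)); last exact: continuous_expR.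
  apply: cvgMr_tmp; apply: cvgN.
  by apply: (@continuous_comp _ _ _ h (fun y => y ^+ 2)); [exact: h_cont|exact: exprn_continuous].
- move=> x; rewrite /D/= in_itv/= andbT => x0.
  rewrite lee_fin !normrM ler_wpM2r// normrX (ger0_norm (expR_ge0 _)) (ger0_norm (expR_ge0 _)).
  by rewrite (ger0_norm C0) HC.
Qed.

Lemma gmoment_ge0 s : 0 <= gmoment s.
Proof.
apply: Rintegral_ge0 => x; rewrite /D/= in_itv/= andbT => x0.
by rewrite !mulr_ge0 ?exprn_ge0 ?expR_ge0 ?h_ge0 ?p_ge0.
Qed.

Lemma gmoment0 : gmoment 0 = 1.
Proof.
rewrite /gmoment /Rintegral.
have := @ge0_integral_subst _ h h' p h_cont p_cont h0 h_ge0 p_ge0 h_drv hh' h_oo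
  (fun y => expR (- (y ^+ 2) / 2)) (fun y => - expR (- (y ^+ 2) / 2)) 0.
move=> H; under eq_integral do rewrite expr0 mul1r.
suff -> : (\int[mu]_(x in D) (expR (- h x ^+ 2 / 2) * p x)%:E = (0 - - expR (- 0 ^+ 2 / 2))%:E)%E.
  by rewrite /= expr0n/= oppr0 mul0r expR0 opprK add0r.
apply: H.
- move=> y; apply: continuous_comp; last exact: continuous_expR.
  by apply: cvgMr_tmp; apply: cvgN; exact: exprn_continuous.
- by move=> y _; rewrite expR_ge0.
- move=> y; apply: is_derive_eq.
  by rewrite /GRing.scale /=; field.
- rewrite -oppr0; apply: cvgN.
  have := @exprn_gauss_cvg0 R 0; apply: cvg_trans; apply: near_eq_cvg.
  by near=> y; rewrite expr0 mul1r.
Unshelve. all: by end_near. Qed.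

(* The constant [C] makes the integrand of the integration by parts nonnegative, so that
   the fundamental theorem of calculus on an unbounded interval applies. *)
Lemma gmomentSS s : gmoment s.+2 = s.+2%:R * gmoment s.
Proof.
pose C : R := s.+2%:R ^+ s.+1.
have := @ge0_integral_subst _ h h' p h_cont p_cont h0 h_ge0 p_ge0 h_drv hh' h_oo
  (fun y => (y ^+ s.+2 - s.+2%:R * y ^+ s + C) * expR (- (y ^+ 2) / 2))
  (fun y => - ((y ^+ s.+2 + C) * expR (- (y ^+ 2) / 2))) 0.
have -> : (\int[mu]_(x in D) ((h x ^+ s.+2 - s.+2%:R * h x ^+ s + C) * expR (- (h x ^+ 2) / 2) * p x)%:E
   = (gmoment s.+2 - s.+2%:R * gmoment s + C * gmoment 0)%:E)%E.
  have I0 := integrable_gmoment 0; have I1 := integrable_gmoment s.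
  have I2 := integrable_gmoment s.+2.
  have I12 := integrable_lincomb I2 I1 mD 1 (- s.+2%:R).
  have <- : \int[mu]_(x in D) ((h x ^+ s.+2 - s.+2%:R * h x ^+ s + C) * expR (- (h x ^+ 2) / 2) * p x)
    = gmoment s.+2 - s.+2%:R * gmoment s + C * gmoment 0.
    transitivity (1 * (1 * gmoment s.+2 + (- s.+2%:R) * gmoment s) + C * gmoment 0); last by ring.
    rewrite -(Rintegral_lincomb I2 I1 mD) -(Rintegral_lincomb I12 I0 mD).
    by apply: eq_Rintegral => x _; ring.
  rewrite /Rintegral fineK//; apply: integrable_fin_num => //.
  apply: eq_integrable (integrable_lincomb I12 I0 mD 1 C) => // x _.
  by congr EFin; ring.
move=> H; have {H} : (gmoment s.+2 - s.+2%:R * gmoment s + C * gmoment 0)%:E = (0 - (- ((0 ^+ s.+2 + C) * expR (- (0 ^+ 2) / 2))))%:E.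
  apply: H.
  - move=> y; apply: cvgM.
      apply: cvgD; last exact: cvg_cst.
      apply: cvgB; first exact: exprn_continuous.
      by apply: cvgMl_tmp; exact: exprn_continuous.
    apply: continuous_comp; last exact: continuous_expR.
    by apply: cvgMr_tmp; apply: cvgN; exact: exprn_continuous.
  - move=> y y0; rewrite mulr_ge0 ?expR_ge0//.
    have C0 : 0 <= C by rewrite exprn_ge0.
    (* Up to [s.+2] the constant [C] dominates the negative term; beyond, y^2 >= s + 2, so the
       leading power does. *)
    have [ys|ys] := leP y s.+2%:R.
      have : s.+2%:R * y ^+ s <= C.
        by rewrite /C exprS ler_wpM2l// lerXn2r// nnegrE.
      by have := exprn_ge0 s.+2 y0; lra.
    rewrite addr_ge0// subr_ge0 exprS; apply: le_trans (_ : y * y ^+ s <= _).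
      by rewrite ler_wpM2r ?exprn_ge0// ltW.
    rewrite exprS; apply: ler_wpM2l => //; rewrite ler_peMl ?exprn_ge0//.
    by apply: le_trans (ltW ys); rewrite ler1n.
  - by move=> y; exact: is_derive_exprn_gauss.
  - rewrite (_ : (fun y => _) = (fun y => - (y ^+ s.+2 * expR (- (y ^+ 2) / 2)) - C * (y ^+ 0 * expR (- (y ^+ 2) / 2)))); last first.
      by apply/funext => y; ring.
    rewrite [X in _ --> X](_ : _ = - 0 - C * 0); last by ring.
    by apply: cvgB; [apply: cvgN|apply: cvgMl_tmp]; exact: exprn_gauss_cvg0.
rewrite gmoment0 expr0n/= expr0n/= oppr0 mul0r expR0 => -[]; lra.
Qed.

Lemma quad_ge0_le (a b c : R) : 0 <= a ->
  (forall u : R, 0 <= a * u ^+ 2 - 2 * b * u + c) -> b ^+ 2 <= a * c.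
Proof.
rewrite le_eqVlt => /predU1P[<-|a0] H.
  rewrite mul0r; have [->|b0] := eqVneq b 0; first by rewrite expr0n.
  have := H ((c + 1) / (2 * b)).
  have -> : 0 * ((c + 1) / (2 * b)) ^+ 2 - 2 * b * ((c + 1) / (2 * b)) + c = -1 by field.
  by rewrite ler0N1.
have := H (b / a).
have -> : a * (b / a) ^+ 2 - 2 * b * (b / a) + c = (a * c - b ^+ 2) / a by field; rewrite gt_eqF.
by rewrite pmulr_lge0 ?invr_gt0// subr_ge0.
Qed.

(** Cauchy-Schwarz, from the nonnegativity of the integral of h^s (u - h)^2 against the weight, for
    all real [u]. *)
Lemma gmoment_logconvex s : gmoment s.+1 ^+ 2 <= gmoment s * gmoment s.+2.
Proof.
apply: quad_ge0_le; first exact: gmoment_ge0.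
move=> u.
have I0 := integrable_gmoment s; have I1 := integrable_gmoment s.+1.
have I2 := integrable_gmoment s.+2.
have I01 := integrable_lincomb I0 I1 mD (u ^+ 2) (- (2 * u)).
rewrite (_ : _ + _ = 1 * ((u ^+ 2) * gmoment s + (- (2 * u)) * gmoment s.+1) + 1 * gmoment s.+2); last by ring.
rewrite -(Rintegral_lincomb I0 I1 mD) -(Rintegral_lincomb I01 I2 mD).
apply: Rintegral_ge0 => x; rewrite /D/= in_itv/= andbT => x0.
have := h_ge0 x x0; have := p_ge0 x x0; have := expR_ge0 (- (h x ^+ 2) / 2).
move: (expR _) => e e0 p0 hx0.
rewrite (_ : _ + _ = (h x ^+ s * e * p x) * (u - h x) ^+ 2).
  by rewrite mulr_ge0 ?sqr_ge0// !mulr_ge0// exprn_ge0.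
by rewrite !exprS; ring.
Qed.

End Moments.

(** * Asymptotics of the factorial moments *)

Section Asymptotics.
Variable R : realType.
Local Arguments bcoef : simpl never.

(** The coefficient of z^m in (1 - z)^(-(s + 1)/2). *)
Definition ccoef (s m : nat) : R := bcoef R s.+1%:R m / 4 ^+ m.

Lemma ccoef_gt0 s m : 0 < ccoef s m.
Proof. by rewrite divr_gt0 ?exprn_gt0// bcoef_gt0 ?ltr0n. Qed.

Lemma ccoef1 m : ccoef 1 m = 1.
Proof.
elim: m => [|m IH]; first by rewrite /ccoef bcoef0 expr0 divr1.
have m0 : m.+1%:R != 0 :> R by rewrite pnatr_eq0.
have e0 : 4 ^+ m != 0 :> R by rewrite expf_neq0.
apply: (mulfI m0); rewrite -{2}IH /ccoef mulrA bcoefS exprS -natr1.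
by field.
Qed.

(** Coefficientwise form of (2 z d/dz + a) (1 - 4 z)^(-a/2) = a (1 - 4 z)^(-(a + 2)/2). It reduces
    the asymptotics for all [s] to [s = 0] and [s = 1]. *)
Lemma bcoefSS (a : R) m : 0 < a -> a * bcoef R (a + 2) m = (2 * m%:R + a) * bcoef R a m.
Proof.
move=> a0; elim: m => [|m IH]; first by rewrite !bcoef0 mulr0 add0r.
have m0 : m.+1%:R != 0 :> R by rewrite pnatr_eq0.
apply: (mulfI m0); rewrite mulrCA bcoefS mulrCA IH [RHS]mulrCA bcoefS -natr1; ring.
Qed.

Lemma ccoefSS s m : ccoef s.+2 m = (2 * m%:R + s.+1%:R) / s.+1%:R * ccoef s m.
Proof.
have s0 : s.+1%:R != 0 :> R by rewrite pnatr_eq0.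
apply: (mulfI s0); rewrite /ccoef mulrA.
have -> : s.+3%:R = s.+1%:R + 2 :> R by rewrite -natrD addn2.
rewrite bcoefSS ?ltr0n//; move: (s.+1%:R) s0 => a a0.
by field; rewrite a0 expf_neq0.
Qed.

Lemma ccoef0S m : m.+1%:R *+ 2 * ccoef 0 m.+1 = (2 * m%:R + 1) * ccoef 0 m.
Proof.
rewrite /ccoef -[1%:R]/(1 : R).
have e0 : 4 ^+ m != 0 :> R by rewrite expf_neq0.
transitivity (m.+1%:R * bcoef R 1 m.+1 / (4 ^+ m * 2)); first by rewrite exprS; field.
by rewrite bcoefS; field.
Qed.

(* The only properties of the moments of the Rayleigh distribution that are needed to
   identify them; log-convexity pins down the value at [1] as in the Bohr-Mollerup theorem. *)
Record rayleigh_seq (M : nat -> R) : Prop := RayleighSeq {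
  rayleigh_seq0 : M 0%N = 1;
  rayleigh_seqSS : forall s, M s.+2 = s.+2%:R * M s;
  rayleigh_seq_ge0 : forall s, 0 <= M s;
  rayleigh_seq_logconvex : forall s, M s.+1 ^+ 2 <= M s * M s.+2 }.

Section Sequence.
Variable M : nat -> R.
Hypothesis HM : rayleigh_seq M.

Lemma rayleigh_seq1_gt0 : 0 < M 1.
Proof.
have := rayleigh_seq_logconvex _ HM 1.
rewrite !(rayleigh_seqSS _ HM) (rayleigh_seq0 _ HM) lt_neqAle (rayleigh_seq_ge0 _ HM) andbT.
by move=> H; apply/eqP => M10; move: H; rewrite -M10; lra.
Qed.

Lemma rayleigh_seq_gt0 s : 0 < M s.
Proof.
suff : 0 < M s /\ 0 < M s.+1 by case.
elim: s => [|s [IH1 IH2]]; first by rewrite (rayleigh_seq0 _ HM) ltr01 rayleigh_seq1_gt0.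
by split=> //; rewrite (rayleigh_seqSS _ HM) mulr_gt0 ?ltr0n.
Qed.

(** M_(2n) and M_(2n+1) are products of even and of odd numbers, and the ratio of the two double
    factorials is a central binomial coefficient. *)
Lemma rayleigh_seq_odd n : M n.*2.+1 = M 1 * (2 * n%:R + 1) * ccoef 0 n * M n.*2.
Proof.
elim: n => [|n IH].
  by rewrite (rayleigh_seq0 _ HM) /ccoef bcoef0 expr0 divr1 mulr0 add0r !mulr1.
rewrite doubleS !(rayleigh_seqSS _ HM) IH.
have -> : n.*2.+3%:R = 2 * n%:R + 3 :> R by rewrite -!natr1 -muln2 natrM; ring.
have -> : n.*2.+2%:R = n.+1%:R *+ 2 :> R by rewrite -mulrnA muln2 doubleS.
rewrite [X in _ = X](_ : _ = M 1 * (2 * n.+1%:R + 1) * (n.+1%:R *+ 2 * ccoef 0 n.+1) * M n.*2); last by ring.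
by rewrite ccoef0S -natr1; ring.
Qed.

(** Log-convexity encloses the odd moment M_(2n+1) between its even neighbours: its instance at 2n
    gives the upper bound [U], and the one at 2n - 1 the lower bound [L], which is why n = 0 is
    treated apart. *)
Lemma wallis_bounds n :
  1 - n.+1%:R^-1 <= M 1 ^+ 2 * (2 * n%:R) * ccoef 0 n ^+ 2 <= 1.
Proof.
have Mn := rayleigh_seq_gt0 n.*2.
have H1 := rayleigh_seq_logconvex _ HM n.*2.
have U : M 1 ^+ 2 * (2 * n%:R + 1) ^+ 2 * ccoef 0 n ^+ 2 <= 2 * n%:R + 2.
  rewrite -(ler_pM2r (exprn_gt0 2 Mn)); move: H1.
  rewrite rayleigh_seq_odd (rayleigh_seqSS _ HM).
  have -> : n.*2.+2%:R = 2 * n%:R + 2 :> R by rewrite -!natr1 -muln2 natrM; ring.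
  by move=> H1; apply: le_trans (le_trans H1 _); rewrite le_eqVlt; apply/orP; left; apply/eqP; ring.
case: n {H1} Mn U => [|n] Mn U; first by rewrite invr1 subrr !mulr0 mul0r lexx ler01.
have L : 2 * n.+1%:R + 1 <= M 1 ^+ 2 * (2 * n.+1%:R + 1) ^+ 2 * ccoef 0 n.+1 ^+ 2.
  rewrite -(ler_pM2r (exprn_gt0 2 Mn)).
  have := rayleigh_seq_logconvex _ HM n.*2.+1; rewrite -[n.*2.+3]/(n.+1.*2.+1) -[n.*2.+2]/(n.+1.*2) => H1.
  have H3 : M n.+1.*2.+1 = (2 * n.+1%:R + 1) * M n.*2.+1.
    rewrite doubleS (rayleigh_seqSS _ HM); congr (_ * _).
    by rewrite -!natr1 -muln2 natrM; ring.
  have x0 : 0 <= 2 * n.+1%:R + 1 :> R by rewrite addr_ge0// mulr_ge0.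
  apply: le_trans (ler_wpM2l x0 H1) _.
  rewrite [leLHS](_ : _ = M n.+1.*2.+1 ^+ 2); last by rewrite expr2 H3; ring.
  by rewrite rayleigh_seq_odd le_eqVlt; apply/orP; left; apply/eqP; ring.
move: U L.
set x : R := n.+1%:R; set q := M 1 ^+ 2; set c := ccoef 0 n.+1 ^+ 2 => U L.
have x1 : 1 <= x by rewrite ler1n.
have y0 : 0 < (2 * x + 1) ^+ 2 by rewrite exprn_gt0//; lra.
have z0 : 0 < 2 * x + 1 by lra.
have -> : q * (2 * x) * c = (q * (2 * x + 1) ^+ 2 * c) * (2 * x) / (2 * x + 1) ^+ 2.
  by field; rewrite gt_eqF.
apply/andP; split; last first.
  rewrite ler_pdivrMr// mul1r; apply: le_trans (ler_wpM2r _ U) _; first by lra.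
  by nra.
rewrite ler_pdivlMr//; apply: le_trans (ler_wpM2r _ L); last by lra.
rewrite -natr1 -/x (_ : 1 - (x + 1)^-1 = x / (x + 1)); last by field; rewrite gt_eqF//; lra.
by rewrite mulrAC ler_pdivrMr; [nra|lra].
Qed.

End Sequence.
End Asymptotics.

Section Limits.
Variable R : realType.
Local Arguments bcoef : simpl never.

Section Sequence.
Variable M : nat -> R.
Hypothesis HM : rayleigh_seq R M.

Lemma wallis_cvg : (fun n : nat => Num.sqrt 2 * M 1 * (Num.sqrt n%:R * ccoef R 0 n)) @ \oo --> (1 : R).
Proof.
apply: (@squeeze_cvgr _ _ _ _ (fun n => 1 - n.+1%:R^-1) (fun=> 1)).
- apply: nearW => n; have /andP[L U] := wallis_bounds R M HM n.
  set y := Num.sqrt 2 * _ * _.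
  have y0 : 0 <= y.
    apply: mulr_ge0; apply: mulr_ge0; rewrite ?sqrtr_ge0 //.
      exact: rayleigh_seq_ge0 HM 1%N.
    exact/ltW/ccoef_gt0.
  have yE : y ^+ 2 = M 1 ^+ 2 * (2 * n%:R) * ccoef R 0 n ^+ 2.
    by rewrite /y !exprMn !sqr_sqrtr//; ring.
  rewrite -yE in L U.
  (* Once 0 <= y <= 1, also y^2 <= y, so the lower bound for the square serves for y itself. *)
  have y1 : y <= 1 by rewrite -(@expr_le1 _ 2).
  rewrite y1 andbT; apply: (le_trans L).
  by rewrite expr2 -[leRHS]mul1r ler_wpM2r.
- rewrite -[X in _ --> X]subr0; apply: cvgB; first exact: cvg_cst.
  exact: cvg_harmonic.
- exact: cvg_cst.
Qed.

End Sequence.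

(** In [wallis_cvg] the sequence enters only through [M 1], whereas the limit is always 1. Hence
    [M 1] is determined, and the recursion of step two does the rest. *)
Lemma rayleigh_seq_unique (M M' : nat -> R) :
  rayleigh_seq R M -> rayleigh_seq R M' -> M =1 M'.
Proof.
move=> HM HM'.
have M1 := rayleigh_seq1_gt0 R M HM; have M1' := rayleigh_seq1_gt0 R M' HM'.
have E1 : M 1%N = M' 1%N.
  have H1 := wallis_cvg M HM; have H2 := wallis_cvg M' HM'.
  have H3 : (fun n : nat => M' 1 / M 1 * (Num.sqrt 2 * M 1 * (Num.sqrt n%:R * ccoef R 0 n))) @ \oo --> (M' 1 / M 1 * 1 : R).
    by apply: cvgMl_tmp; exact: H1.
  have : M' 1 / M 1 * 1 = 1.
    apply: (cvg_unique (@norm_hausdorff _ _) H3); rewrite (_ : (fun n => _) = (fun n : nat => Num.sqrt 2 * M' 1 * (Num.sqrt n%:R * ccoef R 0 n))) //.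
    by apply/funext => n; field; rewrite gt_eqF.
  by rewrite mulr1 => /divr1_eq.
move=> s; suff : M s = M' s /\ M s.+1 = M' s.+1 by case.
elim: s => [|s [IH1 IH2]]; first by rewrite (rayleigh_seq0 R M HM) (rayleigh_seq0 R M' HM').
by rewrite (rayleigh_seqSS R M HM) (rayleigh_seqSS R M' HM') IH1.
Qed.

Section Ratio.
Variables (M : nat -> R) (m : nat -> nat).
Hypothesis HM : rayleigh_seq R M.
Hypothesis Hm : (fun n => (m n)%:R / n%:R : R) @ \oo --> (1 : R).

Lemma near_ratio_gt0 : \forall n \near \oo, (0 < n)%N /\ n%:R <= 2 * (m n)%:R :> R.
Proof.
near=> n.
have n0 : (0 < n)%N by near: n; exists 1%N.
split=> //; have : 2^-1 < (m n)%:R / n%:R :> R.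
  by near: n; apply: (cvgr_gt (1 : R)) => //; lra.
by rewrite ltr_pdivlMr ?ltr0n// => /ltW; lra.
Unshelve. all: by end_near. Qed.

Lemma ratio_cvgy : m @ \oo --> \oo.
Proof.
apply/cvgnyPge => A; near=> n.
have [n0 H] : (0 < n)%N /\ n%:R <= 2 * (m n)%:R :> R by near: n; exact: near_ratio_gt0.
have An : (A.*2 <= n)%N by near: n; exists A.*2.
by rewrite -natrM ler_nat in H; lia.
Unshelve. all: by end_near. Qed.

Lemma ccoef_ratio_cvg k :
  (fun n => k`!%:R * ccoef R k (m n) / (ccoef R 0 n * Num.sqrt n%:R ^+ k)) @ \oo
   --> Num.sqrt 2 ^+ k * M k.
Proof.
have M1 := rayleigh_seq1_gt0 R M HM.
have s2 : 0 < Num.sqrt 2 :> R by rewrite sqrtr_gt0.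
suff : (fun n => k`!%:R * ccoef R k (m n) / (ccoef R 0 n * Num.sqrt n%:R ^+ k)) @ \oo
   --> Num.sqrt 2 ^+ k * M k /\
   (fun n => k.+1`!%:R * ccoef R k.+1 (m n) / (ccoef R 0 n * Num.sqrt n%:R ^+ k.+1)) @ \oo
   --> Num.sqrt 2 ^+ k.+1 * M k.+1 by case.
have W := wallis_cvg M HM.
elim: k => [|k [IH1 IH2]].
  split.
    have Wm := cvg_comp _ _ ratio_cvgy W.
    have S : (fun n => Num.sqrt ((m n)%:R / n%:R : R)) @ \oo --> (1 : R).
      rewrite -[X in _ --> X]sqrtr1; apply: (cvg_comp _ _ Hm); exact: sqrt_continuous.
    (* Wallis' formula along [m n] divided by the one along [n]: the constants cancel and only
       sqrt(m n / n) remains. *)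
    have L : (fun n => (Num.sqrt 2 * M 1 * (Num.sqrt (m n)%:R * ccoef R 0 (m n))) *
        (Num.sqrt 2 * M 1 * (Num.sqrt n%:R * ccoef R 0 n))^-1 * (Num.sqrt ((m n)%:R / n%:R : R))^-1) @ \oo
        --> (1 * 1^-1 * 1^-1 : R).
      by apply: cvgM; [apply: cvgM => //; apply: cvgV => //|apply: cvgV => //]; exact: oner_neq0.
    rewrite expr0 mul1r (rayleigh_seq0 R M HM).
    move: L; rewrite invr1 !mulr1; apply: cvg_trans; apply: near_eq_cvg.
    near=> n.
    have [n0 H] : (0 < n)%N /\ n%:R <= 2 * (m n)%:R :> R by near: n; exact: near_ratio_gt0.
    have sn : 0 < Num.sqrt n%:R :> R by rewrite sqrtr_gt0 ltr0n.
    have sm : 0 < Num.sqrt (m n)%:R :> R.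
      have n0' : 0 < n%:R :> R by rewrite ltr0n.
      by rewrite sqrtr_gt0; lra.
    have c0 := ccoef_gt0 R 0 n.
    rewrite sqrtrM// sqrtrV// expr0 fact0 mul1r mulr1.
    by field; rewrite !gt_eqF.
  have L : (fun n => (Num.sqrt 2 * M 1) * (Num.sqrt 2 * M 1 * (Num.sqrt n%:R * ccoef R 0 n))^-1) @ \oo --> (Num.sqrt 2 * M 1 * 1^-1 : R).
    by apply: cvgMl_tmp; apply: cvgV => //; exact: oner_neq0.
  move: L; rewrite invr1 mulr1 expr1; apply: cvg_trans; apply: near_eq_cvg.
  near=> n.
  have n0 : (0 < n)%N by near: n; exists 1%N.
  have sn : 0 < Num.sqrt n%:R :> R by rewrite sqrtr_gt0 ltr0n.
  have c0 := ccoef_gt0 R 0 n.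
  by rewrite ccoef1 expr1 factS fact0 mulr1; field; rewrite !gt_eqF.
split=> //.
(* The second factor is (k + 1)(k + 2) / n times the factor of [ccoefSS]; it tends to 2 (k + 2),
   matching the recursion of [M] and sqrt 2 squared. *)
have L : (fun n => (k`!%:R * ccoef R k (m n) / (ccoef R 0 n * Num.sqrt n%:R ^+ k)) *
   (k.+2%:R * (2 * ((m n)%:R / n%:R) + k.+1%:R * n%:R^-1))) @ \oo --> (Num.sqrt 2 ^+ k * M k) * (k.+2%:R * (2 * 1 + k.+1%:R * 0)).
  apply: cvgM => //; apply: cvgMl_tmp; apply: cvgD; apply: cvgMl_tmp => //.
  have P : \forall n \near \oo, 0 < (n%:R : R) by near=> n; rewrite ltr0n; near: n; exists 1%N.
  exact: ((gtr0_cvgV0 P).2 cvgr_idn).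
have -> : Num.sqrt 2 ^+ k.+2 * M k.+2 = (Num.sqrt 2 ^+ k * M k) * (k.+2%:R * (2 * 1 + k.+1%:R * 0)) :> R.
  rewrite (rayleigh_seqSS R M HM) !exprS.
  transitivity (Num.sqrt 2 ^+ 2 * (Num.sqrt 2 ^+ k * M k * k.+2%:R) : R); first by ring.
  by rewrite sqr_sqrtr//; ring.
move: L; apply: cvg_trans; apply: near_eq_cvg; near=> n.
have n0 : (0 < n)%N by near: n; exists 1%N.
have sn : 0 < Num.sqrt n%:R :> R by rewrite sqrtr_gt0 ltr0n.
have c0 := ccoef_gt0 R 0 n.
have k1 : k.+1%:R != 0 :> R by rewrite pnatr_eq0.
have nE := sqr_sqrtr (ler0n R n).
rewrite ccoefSS !factS !natrM !exprS.
have q0 := exprn_gt0 k sn.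
move: q0 sn nE; set r := Num.sqrt n%:R => q0 r0 <-.
move: (k.+2%:R) (k.+1%:R) k1 (r ^+ k) q0 => a b b0 q q0.
by field; rewrite b0 !gt_eqF.
Unshelve. all: by end_near. Qed.

End Ratio.

(** By [lambdaE] the factor f_j^s / 4^(s j) cancels, and the quotient becomes the one of
    [ccoef_ratio_cvg] with [m n = n - s * j n]. *)
Lemma ffact_moment_cvg (M : nat -> R) (j : nat -> nat) (s : nat) :
  rayleigh_seq R M ->
  (forall n, (0 < n)%N -> (1 <= j n <= n)%N) ->
  (fun n => (j n)%:R / n%:R : R) @ \oo --> (0 : R) ->
  (fun n => Ebridge (fun w : steps n => ((Xvis (j n) w) ^_ s)%:R) / lambda R n (j n) ^+ s)
    @ \oo --> M s.
Proof.
move=> HM Hj j0.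
have jn : \forall n \near \oo, (0 < n)%N /\ (s * j n <= n)%N.
  near=> n.
  have n0 : (0 < n)%N by near: n; exists 1%N.
  split=> //; have : (j n)%:R / n%:R < s.+1%:R^-1 :> R.
    by near: n; apply: (cvgr_lt (0 : R)) => //; rewrite invr_gt0 ltr0n.
  rewrite ltr_pdivrMr ?ltr0n// mulrC ltr_pdivlMr ?ltr0n// -natrM ltr_nat => H.
  by apply: leq_trans (ltnW H); rewrite mulnC leq_mul2l leqnSn orbT.
have Hm : (fun n => (n - s * j n)%N%:R / n%:R : R) @ \oo --> (1 : R).
  have L : (fun n => 1 - s%:R * ((j n)%:R / n%:R) : R) @ \oo --> (1 - s%:R * 0 : R).
    by apply: cvgB; [exact: cvg_cst|apply: cvgMl_tmp].
  move: L; rewrite mulr0 subr0; apply: cvg_trans; apply: near_eq_cvg; near=> n.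
  have [n0 H] : (0 < n)%N /\ (s * j n <= n)%N by near: n; exact: jn.
  by rewrite natrB// natrM; field; rewrite pnatr_eq0; lia.
have L : (fun n => (Num.sqrt 2 ^+ s)^-1 * (s`!%:R * ccoef R s (n - s * j n) /
     (ccoef R 0 n * Num.sqrt n%:R ^+ s))) @ \oo --> (Num.sqrt 2 ^+ s)^-1 * (Num.sqrt 2 ^+ s * M s).
  by apply: cvgMl_tmp; exact: ccoef_ratio_cvg.
have s2 : 0 < Num.sqrt 2 :> R by rewrite sqrtr_gt0.
move: L; rewrite mulKf ?expf_neq0 ?gt_eqF//.
apply: cvg_trans; apply: near_eq_cvg; near=> n.
have [n0 H] : (0 < n)%N /\ (s * j n <= n)%N by near: n; exact: jn.
have /andP[j1 _] := Hj n n0.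
have sn : 0 < Num.sqrt n%:R :> R by rewrite sqrtr_gt0 ltr0n.
rewrite Ebridge_ffact// lambdaE// /ccoef !exprMn exprVn -exprM.
have f0 : 0 < nfirst R (j n).
  by case: (j n) j1 => // i _; rewrite nfirstE bcoefN1E divr_gt0 ?mulr_gt0 ?ltr0n ?bin_gt0// -addnn leq_addr.
have -> : 4 ^+ n = 4 ^+ (n - s * j n) * 4 ^+ (j n * s) :> R.
  by rewrite -exprD mulnC subnK // mulnC.
have b0 : 0 < bcoef R 1%:R n by rewrite bcoef_gt0.
rewrite -[bcoef R 1 n]/(bcoef R 1%:R n).
by field; rewrite !expf_neq0 ?gt_eqF.
Unshelve. all: by end_near. Qed.

End Limits.

(** * The Rayleigh moments and the Gamma integral *)

Section RayleighMoments.
Variable R : realType.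
Let mu := @lebesgue_measure R.

Lemma is_derive_sqrt2x (x : R) : 0 < x ->
  is_derive x 1 (fun x => Num.sqrt (2 * x)) (Num.sqrt (2 * x))^-1.
Proof.
move=> x0; have y0 : 0 < 2 * x by rewrite mulr_gt0.
have d1 : is_derive x 1 (fun x : R => 2 * x) 2.
  by apply: is_derive_eq; rewrite /GRing.scale /= mulr1.
have d2 := is_derive1_sqrt y0.
apply: (is_derive_eq (is_derive1_comp d2 d1)).
by rewrite invfM /GRing.scale /=; field; rewrite gt_eqF// sqrtr_gt0.
Qed.

Lemma cvg_sqrt2x_pinfty : Num.sqrt (2 * x) @[x --> +oo] --> (+oo : set_system R).
Proof.
apply/cvgryPge => A; near=> x.
have x0 : 0 <= x by near: x; exact: (nbhs_pinfty_ge (num_real _)).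
have xA : A ^+ 2 <= x by near: x; exact: (nbhs_pinfty_ge (num_real _)).
have [A0|A0] := leP A 0; first by apply: le_trans A0 _; rewrite sqrtr_ge0.
rewrite -(ger0_norm (ltW A0)) -sqrtr_sqr ler_wsqrtr//.
by apply: le_trans xA _; lra.
Unshelve. all: by end_near. Qed.

Lemma rayleigh_seq_gmoment (h h' p : R -> R) : continuous h -> continuous p -> h 0 = 0 ->
  (forall x : R, 0 <= x -> 0 <= h x) -> (forall x : R, 0 <= x -> 0 <= p x) ->
  (forall x : R, 0 < x -> is_derive x 1 h (h' x)) ->
  (forall x : R, 0 < x -> h x * h' x = p x) -> h x @[x --> +oo] --> +oo ->
  rayleigh_seq R (gmoment R h p).
Proof.
move=> *; split.
- exact: (gmoment0 R h h' p).
- exact: (gmomentSS R h h' p).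
- exact: (gmoment_ge0 R h p).
- exact: (gmoment_logconvex R h h' p).
Qed.

Lemma rayleigh_seq_id : rayleigh_seq R (gmoment R id id).
Proof.
apply: (rayleigh_seq_gmoment id (fun=> 1)) => //.
- by move=> x; exact: cvg_id.
- by move=> x; exact: cvg_id.
- by move=> x _; rewrite mulr1.
Qed.

(** For h = sqrt(2 x) the Gaussian becomes e^(-x) and h^s is 2^(s/2) x^(s/2), so these moments are
    the values 2^(s/2) Gamma(s/2 + 1). *)
Lemma rayleigh_seq_sqrt2x : rayleigh_seq R (gmoment R (fun x => Num.sqrt (2 * x)) (fun=> 1)).
Proof.
apply: (rayleigh_seq_gmoment _ (fun x => (Num.sqrt (2 * x))^-1)) => //.
- move=> x; apply: (@continuous_comp _ _ _ (fun x : R => 2 * x) Num.sqrt).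
    by apply: cvgMl_tmp; exact: cvg_id.
  exact: sqrt_continuous.
- by move=> x; exact: cvg_cst.
- by rewrite mulr0 sqrtr0.
- exact: is_derive_sqrt2x.
- by move=> x x0; rewrite divff// gt_eqF// sqrtr_gt0 mulr_gt0.
- exact: cvg_sqrt2x_pinfty.
Qed.

Lemma rayleigh_integrandE (g : R -> R) :
  (fun x => g x * rayleigh_pdf x) = (fun x => g x * expR (- x ^+ 2 / 2) * x) \_ `[0, +oo[.
Proof.
apply/funext => x; rewrite patchE /rayleigh_pdf mem_setE in_itv/= andbT.
by case: ifP => _; rewrite ?mulr0//; ring.
Qed.

Lemma rayleigh_momentE : @rayleigh_moment R =1 gmoment R id id.
Proof.
move=> s; rewrite /rayleigh_moment rayleigh_integrandE -Rintegral_mkcond.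
by rewrite /gmoment.
Qed.

Lemma rayleigh_seq_moment : rayleigh_seq R (@rayleigh_moment R).
Proof. by rewrite (funext rayleigh_momentE); exact: rayleigh_seq_id. Qed.

Lemma Gamma_rayleigh s :
  (2 : R) `^ (s%:R / 2) * Gamma (s%:R / 2 + 1) = rayleigh_moment R s.
Proof.
rewrite rayleigh_momentE (rayleigh_seq_unique R _ _ rayleigh_seq_id rayleigh_seq_sqrt2x).
have I : mu.-integrable `[0%R, +oo[ (EFin \o (fun x : R =>
    Num.sqrt (2 * x) ^+ s * expR (- (Num.sqrt (2 * x) ^+ 2) / 2) * 1)).
  apply: (integrable_gmoment R (fun x => Num.sqrt (2 * x)) (fun x => (Num.sqrt (2 * x))^-1) (fun=> 1)) => //.
  - move=> x; apply: (@continuous_comp _ _ _ (fun x : R => 2 * x) Num.sqrt).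
      by apply: cvgMl_tmp; exact: cvg_id.
    exact: sqrt_continuous.
  - by move=> x; exact: cvg_cst.
  - by rewrite mulr0 sqrtr0.
  - exact: is_derive_sqrt2x.
  - by move=> x x0; rewrite divff// gt_eqF// sqrtr_gt0 mulr_gt0.
  - exact: cvg_sqrt2x_pinfty.
have {}I : mu.-integrable `]0%R, +oo[ (EFin \o (fun x : R =>
    Num.sqrt (2 * x) ^+ s * expR (- (Num.sqrt (2 * x) ^+ 2) / 2) * 1)).
  apply: (integrableS _ _ _ I) => // x /=; rewrite !in_itv/= !andbT; exact: ltW.
rewrite /gmoment -Rintegral_itv_obnd_cbnd// /Gamma.
have c0 : (2 : R) `^ (s%:R / 2) != 0 by rewrite gt_eqF// powR_gt0.
(* The power of 2 is moved to the side whose integrand is already known to be integrable. *)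
apply: (mulfI (invr_neq0 c0)); rewrite mulKf// -RintegralZl//.
apply: eq_Rintegral => x; rewrite inE/= in_itv/= andbT => x0.
have y0 : 0 <= 2 * x by rewrite mulr_ge0// ltW.
rewrite sqr_sqrtr// mulr1 addrK.
have -> : - (2 * x) / 2 = - x by field.
rewrite mulrA; congr (_ * _); apply: (mulfI c0); rewrite mulrA divff// mul1r.
rewrite -powRM// ?(ltW x0)//.
by rewrite (mulrC s%:R) powRrM powR12_sqrt// powR_mulrn// sqrtr_ge0.
Qed.

End RayleighMoments.

(** * Alternating and Poisson approximations *)

Section Elementary.
Variable R : realType.

Definition exp_taylor (K : nat) (y : R) : R := \sum_(m < K) (- y) ^+ m / m`!%:R.

Lemma is_derive_exp_taylor K (y : R) :
  is_derive y 1 (exp_taylor K.+1) (- exp_taylor K y).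
Proof.
elim: K => [|K IH].
  rewrite /exp_taylor big_ord0 oppr0 (_ : (fun y => _) = cst (1 : R)).
    exact: is_derive_cst.
  by apply/funext => x; rewrite big_ord_recl big_ord0 expr0 divr1 addr0.
have d1 : is_derive y 1 (fun y : R => (- y) ^+ K.+1 / K.+1`!%:R) (- ((- y) ^+ K / K`!%:R)).
  have dX : is_derive (- y) 1 (fun y : R => y ^+ K.+1) (K.+1%:R * (- y) ^+ K).
    by split; [exact: exprn_derivable|rewrite exp_derive /GRing.scale /= mulr1].
  have dN : is_derive y 1 (fun y : R => - y) (-1) by exact: is_deriveNid.
  have := is_deriveM (is_derive1_comp dX dN) (is_derive_cst (K.+1`!%:R^-1 : R) y 1).
  move=> H; apply: (is_derive_eq H); rewrite /GRing.scale /= factS natrM.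
  have k0 : K.+1%:R != 0 :> R by rewrite pnatr_eq0.
  have f0 : K`!%:R != 0 :> R by rewrite pnatr_eq0 -lt0n fact_gt0.
  by move: (K.+1%:R) k0 => a a0; field; rewrite a0 f0.
have -> : exp_taylor K.+2 = exp_taylor K.+1 + (fun y : R => (- y) ^+ K.+1 / K.+1`!%:R).
  by apply/funext => x; rewrite /exp_taylor big_ord_recr.
apply: (is_derive_eq (is_deriveD IH d1)).
by rewrite /exp_taylor big_ord_recr /= opprD.
Qed.

(* The derivative of the remainder of order [K.+1] is that of order [K], up to sign. *)
Lemma exp_taylor_rem K (y : R) : 0 <= y ->
  0 <= (-1) ^+ K * (expR (- y) - exp_taylor K y) <= y ^+ K / K`!%:R.
Proof.
elim: K y => [|K IH] y y0.
  rewrite /exp_taylor big_ord0 subr0 !expr0 fact0 !mul1r invr1 expR_ge0 /=.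
  by rewrite -expR0 ler_expR oppr_le0.
pose r (x : R) := (-1) ^+ K.+1 * (expR (- x) - exp_taylor K.+1 x).
pose q (x : R) := x ^+ K.+1 / K.+1`!%:R - r x.
have dr (x : R) : is_derive x 1 r ((-1) ^+ K * (expR (- x) - exp_taylor K x)).
  have dN : is_derive x 1 (fun y : R => - y) (-1) by exact: is_deriveNid.
  have dE := is_derive1_comp (is_derive_expR (- x)) dN.
  have := is_deriveZ ((-1) ^+ K.+1) (is_deriveB dE (is_derive_exp_taylor K x)).
  move=> H; apply: (is_derive_eq H); rewrite /GRing.scale /= exprS; ring.
have dq (x : R) : is_derive x 1 q (x ^+ K / K`!%:R - (-1) ^+ K * (expR (- x) - exp_taylor K x)).
  have dX : is_derive x 1 (fun y : R => y ^+ K.+1) (K.+1%:R * x ^+ K).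
    by split; [exact: exprn_derivable|rewrite exp_derive /GRing.scale /= mulr1].
  have := is_deriveB (is_deriveM dX (is_derive_cst (K.+1`!%:R^-1 : R) x 1)) (dr x).
  move=> H; apply: (is_derive_eq H); rewrite /GRing.scale /= factS natrM.
  have k0 : K.+1%:R != 0 :> R by rewrite pnatr_eq0.
  have f0 : K`!%:R != 0 :> R by rewrite pnatr_eq0 -lt0n fact_gt0.
  by move: (K.+1%:R) k0 => a a0; field; rewrite a0 f0.
have T0 : exp_taylor K.+1 0 = 1.
  rewrite /exp_taylor big_ord_recl expr0 fact0 invr1 mulr1 big1 ?addr0// => i _.
  by rewrite oppr0 expr0n /= mul0r.
have r0 : r 0 = 0 by rewrite /r T0 oppr0 expR0 subrr mulr0.
have q0 : q 0 = 0 by rewrite /q r0 expr0n mul0r subr0.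
have mono (f f' : R -> R) : (forall x : R, is_derive x 1 f (f' x)) ->
    (forall x, 0 <= x -> 0 <= f' x) -> f 0 <= f y.
  move=> df f0.
  apply: (@ger0_derive1_le_cc _ f 0 y) => //.
  - move=> x; rewrite in_itv/= => /andP[x0 _].
    have dfx := df x.
    by rewrite derive1E derive_val f0// ltW.
  - apply: derivable_within_continuous => x _; by have [] := df x.
  - by rewrite in_itv/= lexx y0.
  - by rewrite in_itv/= lexx y0.
rewrite -/(r y) -{1}r0 (mono _ _ dr) /=; last by move=> x x0; have /andP[] := IH x x0.
rewrite -subr_ge0 -/(q y) -q0; apply: (mono _ _ dq) => x x0.
by rewrite subr_ge0; have /andP[] := IH x x0.
Qed.

Lemma exp_taylor_err K (y : R) : 0 <= y ->
  `|expR (- y) - exp_taylor K y| <= y ^+ K / K`!%:R.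
Proof.
move=> y0; have /andP[r0 r1] := exp_taylor_rem K y y0.
by apply: le_trans r1; rewrite -(ger0_norm r0) normrM normrX normrN1 expr1n mul1r.
Qed.

(** For z > 0 the alternating partial sums of a row of Pascal's triangle telescope to a single entry
    of the row above. *)
Lemma sum_bin_err K (z : nat) :
  `|(z == 0%N)%:R - \sum_(m < K) (-1) ^+ m * 'C(z, m)%:R| <= 'C(z, K)%:R :> R.
Proof.
case: z => [|z].
  case: K => [|K]; first by rewrite big_ord0 subr0 normr1.
  rewrite big_ord_recl expr0 bin0 mul1r big1 ?addr0 ?subrr ?normr0// => i _.
  by rewrite bin0n mulr0.
case: K => [|K]; first by rewrite big_ord0 subr0 normr0 bin0.
have -> : \sum_(m < K.+1) (-1) ^+ m * 'C(z.+1, m)%:R = (-1) ^+ K * 'C(z, K)%:R :> R.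
  elim: K => [|K IH]; first by rewrite big_ord_recl big_ord0 !bin0 addr0.
  by rewrite big_ord_recr /= IH binS natrD exprS; ring.
by rewrite sub0r normrN normrM normrX normrN1 expr1n mul1r normr_nat ler_nat binS leq_addl.
Qed.

(** x = l means that 'C(x, l) = 1 with nothing left over, so the sieve [sum_bin_err] is applied to x
    - l and multiplied by 'C(x, l). *)
Lemma bonferroni (l K x : nat) :
  `|(x == l)%:R - \sum_(m < K) (-1) ^+ m * ((x ^_ (l + m))%:R / (l`!%:R * m`!%:R))|
    <= (x ^_ (l + K))%:R / (l`!%:R * K`!%:R) :> R.
Proof.
have E m : (x ^_ (l + m))%:R / (l`!%:R * m`!%:R) = 'C(x, l)%:R * 'C(x - l, m)%:R :> R.
  have l0 : l`!%:R != 0 :> R by rewrite pnatr_eq0 -lt0n fact_gt0.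
  have m0 : m`!%:R != 0 :> R by rewrite pnatr_eq0 -lt0n fact_gt0.
  apply: (canLR (mulfK _)); first by rewrite mulf_neq0.
  have -> : (x ^_ (l + m) = x ^_ l * (x - l) ^_ m)%N.
    elim: (m) => [|i IH]; first by rewrite addn0 ffactn0 muln1.
    by rewrite addnS !ffactnSr IH -mulnA subnDA.
  by rewrite -!bin_ffact !natrM; ring.
rewrite E; under eq_bigr do rewrite E mulrCA.
rewrite -mulr_sumr; have [xl|lx] := ltnP x l.
  by rewrite bin_small// !mul0r subr0 ltn_eqF// normr0.
have -> : (x == l)%:R = 'C(x, l)%:R * (x - l == 0)%N%:R :> R.
  rewrite subn_eq0; have [->|xl] := eqVneq x l; first by rewrite binn leqnn mulr1.
  by rewrite leqNgt ltn_neqAle eq_sym xl lx mulr0.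
by rewrite -mulrBr normrM normr_nat ler_wpM2l// sum_bin_err.
Qed.

End Elementary.

(** * Poisson weights, their concentration, and the smoothing kernel *)

Section Poisson.
Variable R : realType.

Definition poisson (y : R) (l : nat) : R := y ^+ l / l`!%:R * expR (- y).

Lemma poisson_ge0 y l : 0 <= y -> 0 <= poisson y l.
Proof. by move=> y0; rewrite mulr_ge0 ?expR_ge0// divr_ge0// exprn_ge0. Qed.

Lemma poissonS y l : l.+1%:R * poisson y l.+1 = y * poisson y l.
Proof.
have l0 : l.+1%:R != 0 :> R by rewrite pnatr_eq0.
have f0 : l`!%:R != 0 :> R by rewrite pnatr_eq0 -lt0n fact_gt0.
rewrite /poisson factS natrM exprS.
by move: (l.+1%:R) l0 => a a0; field; rewrite a0 f0.
Qed.

Lemma sum_poisson_cvg y : (fun K => \sum_(0 <= l < K) poisson y l) @ \oo --> (1 : R).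
Proof.
have H : series (exp_coeff y) @ \oo --> expR y by exact: is_cvg_series_exp_coeff.
have L : (fun K => series (exp_coeff y) K * expR (- y)) @ \oo --> expR y * expR (- y).
  by apply: cvgMr_tmp.
move: L; rewrite -expRD subrr expR0; apply: cvg_trans; apply: near_eq_cvg.
by apply: nearW => K; rewrite /series /= mulr_suml.
Qed.

Lemma sum_poisson_le1 y K : 0 <= y -> \sum_(0 <= l < K) poisson y l <= 1.
Proof.
move=> y0; apply: (cvgr_to_ge (sum_poisson_cvg y)); exists K => // n /= Kn.
rewrite [leRHS](@big_cat_nat _ _ _ K) //= lerDl.
by apply: sumr_ge0 => l _; exact: poisson_ge0.
Qed.

(** The variance of a truncated Poisson law in closed form. The boundary term is nonpositive as soon
    as K >= y, which bounds all partial sums of the variance by y. *)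
Lemma sum_poisson_sqr y K :
  \sum_(0 <= l < K.+1) poisson y l * (l%:R - y) ^+ 2 =
  y * (\sum_(0 <= l < K) poisson y l) + y * (y - K%:R) * poisson y K.
Proof.
elim: K => [|K IH]; first by rewrite big_nat1 big_geq//; ring.
rewrite big_nat_recr //= IH [in RHS]big_nat_recr //=.
have H := poissonS y K.
move: (\sum_(_ <= _ < _) _) (poisson y K.+1) (poisson y K) H => S p' p H.
apply/eqP; rewrite -subr_eq0 [X in X == _](_ : _ = (K.+1%:R - y) * (K.+1%:R * p' - y * p)).
  by rewrite H subrr mulr0.
by rewrite -natr1; ring.
Qed.

Lemma sum_poisson_variance y K : 0 <= y ->
  \sum_(0 <= l < K) poisson y l * (l%:R - y) ^+ 2 <= y.
Proof.
move=> y0; pose K' := maxn K (Num.truncn y).+1.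
have yK : y <= K'%:R.
  by apply: (le_trans (ltW (truncnS_gt y))); rewrite ler_nat leq_maxr.
apply: (@le_trans _ _ (\sum_(0 <= l < K'.+1) poisson y l * (l%:R - y) ^+ 2)).
  rewrite [leRHS](@big_cat_nat _ _ _ K) //=; last by rewrite leqW// leq_maxl.
  by rewrite lerDl sumr_ge0// => l _; rewrite mulr_ge0 ?sqr_ge0// poisson_ge0.
rewrite sum_poisson_sqr; apply: (@le_trans _ _ (y * 1 + 0)); last by rewrite mulr1 addr0.
apply: lerD; first by rewrite ler_wpM2l// sum_poisson_le1.
by rewrite mulr_le0_ge0 ?poisson_ge0// mulr_ge0_le0// subr_le0.
Qed.

Lemma poisson_chebyshev_finite y D K (A : pred nat) : 0 <= y -> 0 < D ->
  (forall l, A l -> D <= `|l%:R - y|) ->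
  \sum_(0 <= l < K | A l) poisson y l <= y / D ^+ 2.
Proof.
move=> y0 D0 HA; rewrite ler_pdivlMr ?exprn_gt0//.
apply: le_trans (sum_poisson_variance y K y0).
rewrite mulr_suml big_mkcond /=; apply: ler_sum => l _.
case: ifP => [Al|_]; last by rewrite mulr_ge0 ?sqr_ge0// poisson_ge0.
apply: ler_wpM2l; first exact: poisson_ge0.
by rewrite -[leRHS]real_normK ?num_real// lerXn2r ?nnegrE ?(ltW D0) ?HA.
Qed.

Lemma poisson_chebyshev y D M (A : pred nat) : 0 <= y -> 0 < D ->
  (forall l, (l < M)%N -> ~~ A l -> D <= `|l%:R - y|) ->
  (forall l, (M <= l)%N -> D <= `|l%:R - y|) ->
  1 - y / D ^+ 2 <= \sum_(0 <= l < M | A l) poisson y l.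
Proof.
move=> y0 D0 HA HM; rewrite lerBlDr.
apply: (cvgr_to_le (sum_poisson_cvg y)); exists M => // K /= MK.
pose A' := [pred l | (M <= l)%N || ~~ A l].
have HA' l : A' l -> D <= `|l%:R - y|.
  by move=> /orP[Ml|nA]; [exact: HM|have [/HM//|lM] := leqP M l; exact: HA].
apply: le_trans (_ : _ <= \sum_(0 <= l < M | A l) poisson y l + \sum_(0 <= l < K | A' l) poisson y l) _.
  rewrite (@big_cat_nat _ _ _ M 0 K xpredT) //= (@big_cat_nat _ _ _ M 0 K A') //=.
  rewrite addrA; apply: lerD.
    rewrite (bigID A) /= lerD2l le_eqVlt; apply/orP; left; apply/eqP.
    rewrite [LHS]big_nat_cond [RHS]big_nat_cond; apply: eq_bigl => l /=.
    by case: ltnP; rewrite ?andbF//= => lM; rewrite leqNgt lM.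
  rewrite le_eqVlt; apply/orP; left; apply/eqP.
  rewrite [LHS]big_nat_cond [RHS]big_nat_cond; apply: eq_bigl => l /=.
  by case: (leqP M l).
by rewrite lerD2l; exact: poisson_chebyshev_finite.
Qed.

(** K times the tail is at most the sum of l p_l over l >= K, and l p_l = y p_(l-1). *)
Lemma poisson_markov y K : 0 <= y -> (0 < K)%N ->
  1 - y / K%:R <= \sum_(0 <= l < K) poisson y l.
Proof.
case: K => // K y0 _; rewrite lerBlDr.
have K0 : 0 < K.+1%:R :> R by rewrite ltr0n.
apply: (cvgr_to_le (sum_poisson_cvg y)); exists K.+1 => // n /= Kn.
rewrite (@big_cat_nat _ _ _ K.+1) //= lerD2l ler_pdivlMr// mulr_suml big_add1.
apply: (@le_trans _ _ (y * \sum_(K <= l < n.-1) poisson y l)).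
  rewrite mulr_sumr !big_nat; apply: ler_sum => l /andP[Kl _].
  by rewrite -poissonS mulrC ler_wpM2r ?poisson_ge0// ler_nat.
rewrite -[leRHS]mulr1; apply: ler_wpM2l => //.
apply: le_trans (sum_poisson_le1 y n.-1 y0).
rewrite [leRHS](@big_cat_nat _ _ _ K) //=; last by lia.
by rewrite lerDr sumr_ge0// => l _; exact: poisson_ge0.
Qed.

(** The kernel q_N of the overview as soon as N t < M: the bound [M] then cuts off no term and keeps
    the sum finite. *)
Definition psmooth (N t : R) (M : nat) (x : R) : R :=
  \sum_(0 <= l < M | l%:R / N <= t) poisson (N * x) l.

Lemma psmooth_ge (N t d x : R) (M : nat) : 0 < N -> 0 < d -> 0 <= x ->
  N * t < M%:R ->
  (x <= t - d)%R%:R - x / (N * d ^+ 2) <= psmooth N t M x.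
Proof.
move=> N0 d0 x0 NM; have y0 : 0 <= N * x by rewrite mulr_ge0// ltW.
have D0 : 0 < N * d by rewrite mulr_gt0.
have Q0 : 0 <= psmooth N t M x by apply: sumr_ge0 => l _; exact: poisson_ge0.
have -> : x / (N * d ^+ 2) = (N * x) / (N * d) ^+ 2.
  by field; rewrite !gt_eqF.
have [xt|xt] := leP x (t - d); last first.
  by apply: le_trans Q0; rewrite sub0r oppr_le0 divr_ge0// sqr_ge0.
have P l : N * t <= l%:R -> N * d <= `|l%:R - N * x|.
  move=> Hl; apply: le_trans (ler_norm _); rewrite lerBrDr -mulrDr.
  by apply: le_trans Hl; rewrite ler_pM2l//; lra.
apply: poisson_chebyshev => // l Hl.
  by rewrite -ltNge ltr_pdivlMr// mulrC => /ltW; exact: P.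
by apply: P; apply: le_trans (ltW NM) _; rewrite ler_nat.
Qed.

Lemma psmooth_le (N t d x : R) (M : nat) : 0 < N -> 0 < d -> 0 <= x ->
  psmooth N t M x <= (x <= t + d)%R%:R + x / (N * d ^+ 2).
Proof.
move=> N0 d0 x0; have y0 : 0 <= N * x by rewrite mulr_ge0// ltW.
have D0 : 0 < N * d by rewrite mulr_gt0.
have -> : x / (N * d ^+ 2) = (N * x) / (N * d) ^+ 2.
  by field; rewrite !gt_eqF.
have [xt|xt] := leP x (t + d).
  apply: (@le_trans _ _ 1); last by rewrite lerDl divr_ge0// sqr_ge0.
  apply: le_trans (sum_poisson_le1 _ M y0).
  rewrite /psmooth big_mkcond /=; apply: ler_sum => l _.
  by case: ifP => // _; exact: poisson_ge0.
rewrite add0r; apply: poisson_chebyshev_finite => // l.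
rewrite ler_pdivrMr// mulrC => Hl.
rewrite distrC; apply: le_trans (ler_norm _); rewrite lerBrDr.
apply: (@le_trans _ _ (N * d + N * t)); first by rewrite lerD2l.
by rewrite -mulrDr ler_pM2l//; lra.
Qed.

End Poisson.

(** * Limits of alternating expansions *)

Section Alternating.
Variable R : realType.

(** Choose K with w_K v_K small, then let n grow: the distance from [a n] to [b] is at most the two
    truncation errors plus the difference of two finite sums. *)
Lemma alternating_cvg (a : nat -> R) (b : R) (u : nat -> nat -> R) (v w : nat -> R) :
  (forall K, \forall n \near \oo,
      `|a n - \sum_(m < K) (-1) ^+ m * (w m * u n m)| <= w K * u n K) ->
  (forall K, `|b - \sum_(m < K) (-1) ^+ m * (w m * v m)| <= w K * v K) ->
  (forall m, (fun n => u n m) @ \oo --> v m) ->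
  (fun K => w K * v K) @ \oo --> (0 : R) ->
  a @ \oo --> b.
Proof.
move=> Ha Hb Hu Hw; apply/cvgrPdist_le => e e0.
have e4 : 0 < e / 4 by rewrite divr_gt0.
have [K _ HK] : \forall K \near \oo, w K * v K < e / 4.
  exact: (cvgr_lt (0 : R)).
have wK := HK K (leqnn K).
have C1 : (fun n => w K * u n K) @ \oo --> w K * v K by apply: cvgMl_tmp.
have C2 : (fun n => \sum_(m < K) (-1) ^+ m * (w m * u n m)) @ \oo -->
    \sum_(m < K) (-1) ^+ m * (w m * v m).
  elim: (K) => [|k IH].
    by rewrite big_ord0; under eq_fun do rewrite big_ord0; exact: cvg_cst.
  rewrite big_ord_recr; under eq_fun do rewrite big_ord_recr /=.
  by apply: cvgD => //; do 2! apply: cvgMl_tmp.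
near=> n.
have H1 : w K * u n K < e / 4 by near: n; exact: (cvgr_lt (w K * v K)).
have H2 : `|\sum_(m < K) (-1) ^+ m * (w m * v m) - \sum_(m < K) (-1) ^+ m * (w m * u n m)| <= e / 4.
  by near: n; move/cvgrPdist_le: C2; apply.
have H3 : `|a n - \sum_(m < K) (-1) ^+ m * (w m * u n m)| <= w K * u n K.
  by near: n; exact: Ha.
have H4 := Hb K.
move: (H1) (H2) (H3) (H4) (wK); set A := \sum_(m < K) _; set B := \sum_(m < K) _.
rewrite !ler_norml => G1 /andP[G2 G2'] /andP[G3 G3'] /andP[G4 G4'] G5.
by apply/andP; split; lra.
Unshelve. all: by end_near. Qed.

(** The ratio of terms two apart is of order 1 / K, so (K + 1) t_K eventually decreases in steps of
    two; being bounded, it forces t_K to 0. *)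
Lemma rayleigh_seq_exp_cvg0 (M : nat -> R) (rho : R) (l : nat) : rayleigh_seq R M ->
  0 <= rho -> (fun K => rho ^+ K / K`!%:R * M (l + K)%N) @ \oo --> (0 : R).
Proof.
move=> HM r0; pose t K : R := rho ^+ K / K`!%:R * M (l + K)%N.
have t0 K : 0 <= t K.
  by rewrite mulr_ge0 ?(rayleigh_seq_ge0 R M HM)// divr_ge0// exprn_ge0.
have tSS K : t K.+2 = rho ^+ 2 * (l + K.+2)%:R / (K.+1%:R * K.+2%:R) * t K.
  have f0 : K`!%:R != 0 :> R by rewrite pnatr_eq0 -lt0n fact_gt0.
  have k1 : K.+1%:R != 0 :> R by rewrite pnatr_eq0.
  have k2 : K.+2%:R != 0 :> R by rewrite pnatr_eq0.
  rewrite /t !addnS (rayleigh_seqSS R M HM) !factS !natrM !exprS.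
  move: (K.+2%:R) (K.+1%:R) ((l + K).+2%:R) k1 k2 => a b c a0 b0.
  by field; rewrite f0 a0 b0.
(* From K + 3 <= 3 (K + 1) and l + K + 2 <= (l + 1)(K + 2), the required decrease holds once 3 rho^2
   (l + 1) <= K. *)
pose K0 := (Num.truncn (3 * rho ^+ 2 * l.+1%:R)).+1.
have dec K : (K0 <= K)%N -> K.+3%:R * t K.+2 <= K.+1%:R * t K.
  move=> KK; have x0 : 3 * rho ^+ 2 * l.+1%:R <= K%:R.
    by apply: (le_trans (ltW (truncnS_gt _))); rewrite ler_nat.
  rewrite tSS; move: (t K) (t0 K) => T T0; rewrite !mulrA ler_wpM2r//.
  have k1 : 0 < K.+1%:R :> R by rewrite ltr0n.
  have k2 : 0 < K.+2%:R :> R by rewrite ltr0n.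
  rewrite ler_pdivrMr ?mulr_gt0//.
  have A1 : K.+3%:R <= 3 * K.+1%:R :> R by rewrite -natrM ler_nat; lia.
  have A2 : (l + K.+2)%:R <= l.+1%:R * K.+2%:R :> R by rewrite -natrM ler_nat; nia.
  apply: (@le_trans _ _ (3 * K.+1%:R * rho * rho * (l.+1%:R * K.+2%:R))).
    by apply: ler_pM => //; [rewrite !mulr_ge0|rewrite !ler_wpM2r].
  rewrite [leLHS](_ : _ = (3 * rho ^+ 2 * l.+1%:R) * (K.+1%:R * K.+2%:R)); last by ring.
  apply: ler_wpM2r; first by rewrite mulr_ge0// ltW.
  by apply: le_trans x0 _; rewrite ler_nat.
(* One starting term for each parity. *)
pose B := K0.+1%:R * t K0 + K0.+2%:R * t K0.+1.
have bnd K : K.+1%:R * t (K0 + K)%N <= B.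
  suff : (K0 + K).+1%:R * t (K0 + K)%N <= B /\ (K0 + K).+2%:R * t (K0 + K).+1 <= B.
    case=> H _; apply: le_trans H; rewrite ler_wpM2r// ler_nat; lia.
  elim: K => [|K [IH1 IH2]].
    by rewrite addn0; split; rewrite /B ?lerDl ?lerDr; apply: mulr_ge0.
  rewrite addnS; split=> //; apply: le_trans IH1; apply: dec; exact: leq_addr.
rewrite -(cvg_shiftn K0).
apply: (@squeeze_cvgr _ _ _ _ (fun=> 0) (fun K => B * K.+1%:R^-1)).
- apply: nearW => K; rewrite -/(t _) t0 /= ler_pdivlMr ?ltr0n// mulrC addnC.
  exact: bnd.
- exact: cvg_cst.
- rewrite -(mulr0 B); apply: cvgMl_tmp; exact: cvg_harmonic.
Qed.

End Alternating.

(** * Expectation with respect to the Rayleigh distribution *)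

Section RayleighExpectation.
Variable R : realType.
Let mu := @lebesgue_measure R.
Implicit Types (f g : R -> R) (rho t d : R).

Definition rexp (g : R -> R) : R := \int[mu]_x (g x * rayleigh_pdf x).

Definition rexp_able (g : R -> R) : Prop :=
  mu.-integrable setT (EFin \o (fun x => g x * rayleigh_pdf x)).

Lemma rayleigh_pdf_ge0 (x : R) : 0 <= rayleigh_pdf x.
Proof. by rewrite /rayleigh_pdf; case: ifP => // x0; rewrite mulr_ge0 ?expR_ge0. Qed.

Lemma rayleigh_pdf_lt0 (x : R) : x < 0 -> rayleigh_pdf x = 0.
Proof. by rewrite /rayleigh_pdf ltNge => /negbTE ->. Qed.

Lemma measurable_rayleigh_pdf : measurable_fun setT (@rayleigh_pdf R).
Proof.
have -> : @rayleigh_pdf R = (fun x => expR (- x ^+ 2 / 2) * x) \_ `[0, +oo[.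
  apply/funext => x; rewrite patchE /rayleigh_pdf mem_setE in_itv/= andbT.
  by case: ifP => // _; rewrite mulrC.
apply/(measurable_restrictT _ _).1; first exact: measurable_itv.
apply: measurable_funTS; apply: continuous_measurable_fun => x; apply: cvgM; last exact: cvg_id.
apply: (@continuous_comp _ _ _ (fun x : R => - (x ^+ 2) / 2)); last exact: continuous_expR.
by apply: cvgMr_tmp; apply: cvgN; exact: exprn_continuous.
Qed.

Lemma rexp_able_exprn s : rexp_able (fun x => x ^+ s).
Proof.
rewrite /rexp_able rayleigh_integrandE.
have I : mu.-integrable `[0%R, +oo[ (EFin \o (fun x : R => x ^+ s * expR (- (x ^+ 2) / 2) * x)).
  apply: (integrable_gmoment R id (fun=> 1) id) => //.
  - by move=> x; exact: cvg_id.
  - by move=> x; exact: cvg_id.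
  - by move=> x _; rewrite mulr1.
rewrite -restrict_EFin; apply/(integrable_mkcond _ _).1 => //.
Qed.

(** Domination is asked for on x >= 0 only, the density being 0 elsewhere. *)
Lemma rexp_able_dom f g : measurable_fun setT g ->
  (forall x, 0 <= x -> `|g x| <= f x) -> rexp_able f -> rexp_able g.
Proof.
move=> mg gf; apply: le_integrable => //.
  apply/measurable_EFinP; apply: measurable_funM => //; exact: measurable_rayleigh_pdf.
move=> x _; rewrite lee_fin !normrM; have [x0|x0] := leP 0 x; last first.
  by rewrite rayleigh_pdf_lt0// normr0 !mulr0.
by rewrite ler_wpM2r// (le_trans (gf _ x0))// ler_norm.
Qed.

Lemma rexp_able_lin f g (a b : R) : rexp_able f -> rexp_able g ->
  rexp_able (fun x => a * f x + b * g x).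
Proof.
move=> If Ig; have := integrable_lincomb If Ig measurableT a b.
by apply: eq_integrable => // x _; congr EFin; rewrite mulrDl !mulrA.
Qed.

Lemma rexp_lin f g (a b : R) : rexp_able f -> rexp_able g ->
  rexp (fun x => a * f x + b * g x) = a * rexp f + b * rexp g.
Proof.
move=> If Ig; rewrite /rexp -(Rintegral_lincomb If Ig measurableT).
by apply: eq_Rintegral => x _; rewrite mulrDl !mulrA.
Qed.

Lemma le_rexp f g : rexp_able f -> rexp_able g ->
  (forall x, 0 <= x -> f x <= g x) -> rexp f <= rexp g.
Proof.
move=> If Ig fg; apply: le_Rintegral => // x _.
have [x0|x0] := leP 0 x; last by rewrite rayleigh_pdf_lt0// !mulr0.
by rewrite ler_wpM2r ?rayleigh_pdf_ge0// fg.
Qed.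

Lemma rexp_able0 : rexp_able (fun=> 0).
Proof.
apply: (rexp_able_dom (fun x => x ^+ 0)); [exact: measurable_cst| |exact: rexp_able_exprn].
by move=> x _; rewrite normr0.
Qed.

Lemma rexp0 : rexp (fun=> 0) = 0.
Proof.
have := rexp_lin _ _ 0 0 rexp_able0 rexp_able0; rewrite !mul0r addr0 => H.
by rewrite -[RHS]H; congr rexp; apply/funext => x; rewrite mul0r addr0.
Qed.

Lemma rexp_ableZ f (a : R) : rexp_able f -> rexp_able (fun x => a * f x).
Proof.
move=> If; have := rexp_able_lin f (fun=> 0) a 0 If rexp_able0.
by congr rexp_able; apply/funext => x; rewrite mulr0 addr0.
Qed.

Lemma rexpZ f (a : R) : rexp_able f -> rexp (fun x => a * f x) = a * rexp f.
Proof.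
move=> If; have := rexp_lin f (fun=> 0) a 0 If rexp_able0.
rewrite !mul0r addr0 => <-; congr rexp; apply/funext => x.
by rewrite addr0.
Qed.

Lemma rexp_able_sum (I : Type) (r : seq I) (P : pred I) (F : I -> R -> R) :
  (forall i, rexp_able (F i)) -> rexp_able (fun x => \sum_(i <- r | P i) F i x).
Proof.
move=> IF; elim: r => [|i r IH].
  by under eq_fun do rewrite big_nil; exact: rexp_able0.
under eq_fun do rewrite big_cons; case: (P i) => //.
have := rexp_able_lin _ _ 1 1 (IF i) IH.
by congr rexp_able; apply/funext => x; rewrite !mul1r.
Qed.

Lemma rexp_sum (I : Type) (r : seq I) (P : pred I) (F : I -> R -> R) :
  (forall i, rexp_able (F i)) ->
  rexp (fun x => \sum_(i <- r | P i) F i x) = \sum_(i <- r | P i) rexp (F i).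
Proof.
move=> IF; elim: r => [|i r IH].
  by under eq_fun do rewrite big_nil; rewrite big_nil rexp0.
under eq_fun do rewrite big_cons; rewrite big_cons; case: (P i) => //.
rewrite -IH; have := rexp_lin _ _ 1 1 (IF i) (rexp_able_sum _ r P F IF).
by rewrite !mul1r => <-; congr rexp; apply/funext => x; rewrite !mul1r.
Qed.

Lemma rexp_exprn s : rexp (fun x => x ^+ s) = rayleigh_moment R s.
Proof. by []. Qed.

Lemma measurable_le_indicator t : measurable_fun setT (fun x : R => (x <= t)%R%:R : R).
Proof.
have -> : (fun x : R => (x <= t)%R%:R : R) = \1_(`]-oo, t]).
  by apply/funext => x; rewrite indicE mem_setE in_itv.
exact: measurable_indic.
Qed.

Lemma rexp_able_le t : rexp_able (fun x => (x <= t)%R%:R).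
Proof.
apply: (rexp_able_dom (fun x => x ^+ 0)); [exact: measurable_le_indicator| |exact: rexp_able_exprn].
by move=> x _; rewrite expr0 normr_nat; case: (x <= t).
Qed.

Lemma rayleigh_cdfE t : rayleigh_cdf t = rexp (fun x => (x <= t)%R%:R).
Proof.
rewrite /rayleigh_cdf Rintegral_mkcond; apply: eq_Rintegral => x _.
rewrite patchE mem_setE in_itv /=.
by case: (x <= t); rewrite ?mul1r ?mul0r.
Qed.

Lemma rexp_able_exprn_exp rho l : 0 <= rho ->
  rexp_able (fun x => x ^+ l * expR (- (rho * x))).
Proof.
move=> r0; apply: (rexp_able_dom (fun x => x ^+ l)); last exact: rexp_able_exprn.
  apply: continuous_measurable_fun => x; apply: cvgM; first exact: exprn_continuous.
  apply: (@continuous_comp _ _ _ (fun x : R => - (rho * x))); last exact: continuous_expR.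
  by apply: cvgN; apply: cvgMl_tmp; exact: cvg_id.
move=> x x0; rewrite normrM (ger0_norm (expR_ge0 _)) normrX (ger0_norm x0).
rewrite ler_piMr ?exprn_ge0// -expR0 ler_expR oppr_le0 mulr_ge0//.
Qed.

Lemma poissonE rho l : (fun x => poisson R (rho * x) l) =
  (fun x => rho ^+ l / l`!%:R * (x ^+ l * expR (- (rho * x)))).
Proof. by apply/funext => x; rewrite /poisson exprMn; ring. Qed.

Lemma rexp_able_poisson rho l : 0 <= rho -> rexp_able (fun x => poisson R (rho * x) l).
Proof. by move=> r0; rewrite poissonE; apply: rexp_ableZ; exact: rexp_able_exprn_exp. Qed.

Lemma mpo_pmfE rho l : 0 <= rho -> mpo_pmf rho l = rexp (fun x => poisson R (rho * x) l).
Proof. by move=> r0; rewrite poissonE rexpZ//; exact: rexp_able_exprn_exp. Qed.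

Lemma rexp_taylor rho l K : 0 <= rho ->
  `|rexp (fun x => x ^+ l * expR (- (rho * x))) -
    \sum_(m < K) (-1) ^+ m * (rho ^+ m / m`!%:R * rayleigh_moment R (l + m))| <=
  rho ^+ K / K`!%:R * rayleigh_moment R (l + K).
Proof.
move=> r0; have I := rexp_able_exprn_exp rho l r0.
pose F (m : nat) (x : R) := ((-1) ^+ m * (rho ^+ m / m`!%:R)) * x ^+ (l + m)%N.
have IF m : rexp_able (F m) by apply: rexp_ableZ; exact: rexp_able_exprn.
have IS := rexp_able_sum _ (index_enum 'I_K) xpredT (fun m : 'I_K => F m) (fun m => IF m).
have -> : \sum_(m < K) (-1) ^+ m * (rho ^+ m / m`!%:R * rayleigh_moment R (l + m)) =
    rexp (fun x => \sum_(m < K) F m x).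
  rewrite (rexp_sum _ _ xpredT (fun m : 'I_K => F m) (fun m => IF m)); apply: eq_bigr => m _.
  by rewrite rexpZ ?rexp_exprn ?mulrA//; exact: rexp_able_exprn.
rewrite -rexp_exprn -rexpZ; last exact: rexp_able_exprn.
have E (x : R) : x ^+ l * expR (- (rho * x)) - \sum_(m < K) F m x =
    x ^+ l * (expR (- (rho * x)) - exp_taylor R K (rho * x)).
  rewrite mulrBr; congr (_ - _); rewrite /exp_taylor mulr_sumr; apply: eq_bigr => m _.
  by rewrite /F (exprNn (rho * x)) exprMn exprD; ring.
have B (x : R) : 0 <= x -> `|x ^+ l * expR (- (rho * x)) - \sum_(m < K) F m x| <=
    rho ^+ K / K`!%:R * x ^+ (l + K)%N.
  move=> x0; rewrite E normrM (ger0_norm (exprn_ge0 _ x0)) exprD mulrCA.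
  rewrite ler_wpM2l ?exprn_ge0//; apply: le_trans (exp_taylor_err R K _ (mulr_ge0 r0 x0)) _.
  by rewrite exprMn mulrAC.
have IP : rexp_able (fun x => rho ^+ K / K`!%:R * x ^+ (l + K)%N).
  by apply: rexp_ableZ; exact: rexp_able_exprn.
rewrite ler_norml; apply/andP; split.
  have := le_rexp _ _ IS (rexp_able_lin _ _ 1 1 I IP) => /(_ _).
  rewrite rexp_lin// !mul1r => H; suff : rexp (fun x => \sum_(m < K) F m x) <=
    rexp (fun x => x ^+ l * expR (- (rho * x))) + rexp (fun x => rho ^+ K / K`!%:R * x ^+ (l + K)%N) by lra.
  apply: H => x x0; have := B x x0; rewrite ler_norml => /andP[]; lra.
have := le_rexp _ _ I (rexp_able_lin _ _ 1 1 IS IP) => /(_ _).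
rewrite rexp_lin// !mul1r => H; suff : rexp (fun x => x ^+ l * expR (- (rho * x))) <=
  rexp (fun x => \sum_(m < K) F m x) + rexp (fun x => rho ^+ K / K`!%:R * x ^+ (l + K)%N) by lra.
apply: H => x x0; have := B x x0; rewrite ler_norml => /andP[]; lra.
Qed.

Lemma rexp_able_psmooth N t M : 0 <= N -> rexp_able (psmooth R N t M).
Proof.
by move=> N0; apply: (rexp_able_sum _ _ _ (fun l x => poisson R (N * x) l)) => l; exact: rexp_able_poisson.
Qed.

(** Together with [mpo_scaled_cdfE] for [c = N], this identifies the smoothed Rayleigh law with the
    law of Y / N. *)
Lemma rexp_psmooth N t M : 0 <= N ->
  rexp (psmooth R N t M) = \sum_(0 <= l < M | l%:R / N <= t) mpo_pmf N l.
Proof.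
move=> N0; rewrite (rexp_sum _ _ _ (fun l x => poisson R (N * x) l)); last by move=> l; exact: rexp_able_poisson.
by apply: eq_bigr => l _; rewrite mpo_pmfE.
Qed.

Lemma mpo_scaled_cdfE rho c t M : 0 < c -> c * t < M%:R ->
  mpo_scaled_cdf rho c t = \sum_(0 <= l < M | l%:R / c <= t) mpo_pmf rho l.
Proof.
move=> c0 cM; rewrite /mpo_scaled_cdf /rseries; apply: cvg_lim => //.
apply: (@cvg_trans _ ((fun=> \sum_(0 <= l < M | l%:R / c <= t) mpo_pmf rho l) @ \oo)); last exact: cvg_cst.
apply: near_eq_cvg; exists M => // n /= Mn.
rewrite -(big_mkord xpredT (fun l => if l%:R / c <= t then mpo_pmf rho l else 0)).
rewrite [RHS](@big_cat_nat _ _ _ M) //= [X in _ + X]big_nat [X in _ + X]big1 ?addr0.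
  by rewrite big_mkcond.
move=> l /andP[Ml _]; rewrite ifF//; apply/negbTE; rewrite -ltNge ltr_pdivlMr// mulrC.
by apply: lt_le_trans cM _; rewrite ler_nat.
Qed.

Lemma rexp_psmooth_bounds N t d M : 0 < N -> 0 < d -> N * t < M%:R ->
  rayleigh_cdf (t - d) - rayleigh_moment R 1 / (N * d ^+ 2) <= rexp (psmooth R N t M)
   <= rayleigh_cdf (t + d) + rayleigh_moment R 1 / (N * d ^+ 2).
Proof.
move=> N0 d0 NM; have Iq := rexp_able_psmooth N t M (ltW N0).
have I1 := rexp_able_exprn 1.
rewrite !rayleigh_cdfE (mulrC (rayleigh_moment R 1)); apply/andP; split.
  have := le_rexp _ _ (rexp_able_lin _ _ 1 (- (N * d ^+ 2)^-1) (rexp_able_le (t - d)) I1) Iq => /(_ _).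
  rewrite (rexp_lin _ _ _ _ (rexp_able_le (t - d)) I1) mul1r mulNr rexp_exprn.
  apply=> x x0.
  by apply: le_trans (psmooth_ge R N t d x M N0 d0 x0 NM); rewrite mul1r expr1 mulNr (mulrC x).
have := le_rexp _ _ Iq (rexp_able_lin _ _ 1 ((N * d ^+ 2)^-1) (rexp_able_le (t + d)) I1) => /(_ _).
rewrite (rexp_lin _ _ _ _ (rexp_able_le (t + d)) I1) mul1r rexp_exprn.
apply=> x x0.
by apply: le_trans (psmooth_le R N t d x M N0 d0 x0) _; rewrite mul1r expr1 (mulrC x).
Qed.

End RayleighExpectation.

(** * Limit laws *)

Section BridgeExpectation.
Variables (R : realType) (n : nat).
Implicit Types (f g h : steps n -> R).

Lemma Ebridge_le f g : (forall w, f w <= g w) -> Ebridge f <= Ebridge g.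
Proof. by move=> fg; rewrite /Ebridge ler_wpM2r ?invr_ge0// ler_sum. Qed.

Lemma EbridgeD f g : Ebridge (fun w => f w + g w) = Ebridge f + Ebridge g.
Proof. by rewrite /Ebridge big_split mulrDl. Qed.

Lemma EbridgeZ (a : R) f : Ebridge (fun w => a * f w) = a * Ebridge f.
Proof. by rewrite /Ebridge -mulr_sumr mulrA. Qed.

Lemma Ebridge_sum (I : Type) (r : seq I) (P : pred I) (F : I -> steps n -> R) :
  Ebridge (fun w => \sum_(i <- r | P i) F i w) = \sum_(i <- r | P i) Ebridge (F i).
Proof. by rewrite /Ebridge exchange_big mulr_suml. Qed.

Lemma Ebridge_approx K (c : nat -> R) f h (g : nat -> steps n -> R) :
  (forall w, `|f w - \sum_(m < K) c m * g m w| <= h w) ->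
  `|Ebridge f - \sum_(m < K) c m * Ebridge (g m)| <= Ebridge h.
Proof.
move=> H; have -> : \sum_(m < K) c m * Ebridge (g m) = Ebridge (fun w => \sum_(m < K) c m * g m w).
  by rewrite Ebridge_sum; apply: eq_bigr => m _; rewrite EbridgeZ.
rewrite ler_norml lerBrDr lerBlDr; apply/andP; split.
  rewrite -mulN1r -EbridgeZ -EbridgeD; apply: Ebridge_le => w.
  by have := H w; rewrite ler_norml => /andP[]; lra.
rewrite -EbridgeD; apply: Ebridge_le => w.
by have := H w; rewrite ler_norml => /andP[]; lra.
Qed.

End BridgeExpectation.

(** * From factorial moments to power moments *)

Section Stirling.
Variable R : realType.

(** The [a k] are the Stirling numbers of the second kind. Their vanishing beyond [s] lets the
    induction drop the top term of the shifted sum. *)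
Lemma exprn_ffact s : exists a : nat -> R,
  [/\ a s = 1, forall k, (s < k)%N -> a k = 0 &
      forall x : nat, x%:R ^+ s = \sum_(k < s.+1) a k * (x ^_ k)%:R].
Proof.
elim: s => [|s [a [as1 a0 aE]]].
  exists (fun k => (k == 0%N)%:R); split=> [//|k|x]; first by rewrite lt0n => /negbTE ->.
  by rewrite big_ord_recl big_ord0 ffactn0 expr0 mulr1 addr0.
exists (fun k => (if k is k'.+1 then a k' else 0) + k%:R * a k); split.
- by rewrite as1 a0// mulr0 addr0.
- by case=> // k sk; rewrite !a0 ?mulr0 ?addr0// ltnW.
move=> x; rewrite exprS aE mulr_sumr.
transitivity (\sum_(k < s.+1) (a k * (x ^_ k.+1)%:R + k%:R * a k * (x ^_ k)%:R)).
  apply: eq_bigr => k _; have [kx|xk] := leqP k x.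
    by rewrite ffactnSr natrM natrB//; ring.
  by rewrite !ffact_small ?mulr0 ?addr0// ltnW.
rewrite big_split /=.
under [RHS]eq_bigr do rewrite mulrDl.
rewrite [RHS]big_split /= [X in _ = X + _]big_ord_recl mul0r add0r.
by rewrite [X in _ = _ + X]big_ord_recr /= a0// mulr0 mul0r addr0.
Qed.

(** With [u] the inverse of the scale, all falling factorials below the top degree keep a positive
    power of [u]. The filter is arbitrary because the scale is lambda along n or rho itself. *)
Lemma stirling_cvg {T : Type} (F : set_system T) {FF : Filter F} (a : nat -> R) s
    (u : T -> R) (v : nat -> T -> R) (M : nat -> R) :
  a s = 1 -> u @ F --> (0 : R) -> (forall k, v k @ F --> M k) ->
  (fun x => \sum_(k < s.+1) a k * (v k x * u x ^+ (s - k))) @ F --> M s.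
Proof.
move=> as1 u0 vM.
have L K : (fun x => \sum_(k < K) a k * (v k x * u x ^+ (s - k))) @ F -->
    \sum_(k < K) a k * (M k * 0 ^+ (s - k)).
  elim: K => [|K IH].
    by rewrite big_ord0; under eq_fun do rewrite big_ord0; exact: cvg_cst.
  rewrite big_ord_recr; under eq_fun do rewrite big_ord_recr /=.
  apply: cvgD => //; apply: cvgMl_tmp; apply: cvgM => //.
  exact: (cvg_comp u (fun y : R => y ^+ (s - K)) u0 (@exprn_continuous R (s - K) 0)).
have := L s.+1; rewrite big_ord_recr /= subnn as1 mul1r mulr1 big1 ?add0r// => k _.
by rewrite expr0n subn_eq0 leqNgt ltn_ord mulr0 mulr0.
Qed.

Lemma sum_ffact_poisson (y : R) k N :
  \sum_(0 <= l < N + k) (l ^_ k)%:R * poisson R y l =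
  y ^+ k * \sum_(0 <= l < N) poisson R y l.
Proof.
rewrite (@big_cat_nat _ _ _ k) ?leq_addl//= big_nat big1 ?add0r; last first.
  by move=> l /andP[_ lk]; rewrite ffact_small// mul0r.
rewrite -{1}(add0n k) big_addn addnK mulr_sumr; apply: eq_bigr => l _.
have l0 : l`!%:R != 0 :> R by rewrite pnatr_eq0 -lt0n fact_gt0.
have k0 : ((l + k) ^_ k)%:R != 0 :> R by rewrite pnatr_eq0 -lt0n ffact_gt0 leq_addl.
have := ffact_fact (leq_addl l k); rewrite addnK => H.
by rewrite /poisson -H natrM exprD; field; rewrite l0 k0.
Qed.

(** Summation and expectation are interchanged quantitatively: truncated at N + 1 + k, the sum is
    short of its limit by at most rho^(k+1) mu_(k+1) / (N + 1), by [poisson_markov]. *)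
Lemma mpo_ffact_cvg (rho : R) k : 0 < rho ->
  (fun N => \sum_(0 <= l < N) (l ^_ k)%:R * mpo_pmf rho l) @ \oo -->
  rho ^+ k * rayleigh_moment R k.
Proof.
move=> r0; rewrite -(cvg_shiftn k) -(cvg_shiftS) /=.
pose f N (x : R) := \sum_(0 <= l < N + k) (l ^_ k)%:R * poisson R (rho * x) l.
have Ip l : rexp_able R (fun x => poisson R (rho * x) l) by exact: rexp_able_poisson (ltW r0).
have IF N : rexp_able R (f N).
  by apply: (rexp_able_sum _ _ _ _ (fun l x => (l ^_ k)%:R * poisson R (rho * x) l)) => l; exact: rexp_ableZ.
have fE N : rexp R (f N) = \sum_(0 <= l < N + k) (l ^_ k)%:R * mpo_pmf rho l.
  rewrite (rexp_sum _ _ _ _ (fun l x => (l ^_ k)%:R * poisson R (rho * x) l)); last by move=> l; exact: rexp_ableZ.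
  by apply: eq_bigr => l _; rewrite rexpZ// mpo_pmfE// ltW.
have I0 := rexp_able_exprn R k; have I1 := rexp_able_exprn R k.+1.
have y0 (x : R) : 0 <= x -> 0 <= rho * x by move=> x0; rewrite mulr_ge0// ltW.
apply: (@squeeze_cvgr _ _ _ _ (fun N => rho ^+ k * rayleigh_moment R k
    - (rho ^+ k.+1 * rayleigh_moment R k.+1) * N.+1%:R^-1) (fun=> rho ^+ k * rayleigh_moment R k)).
- apply: nearW => N; rewrite -fE; apply/andP; split.
    have := le_rexp _ _ _ (rexp_able_lin _ _ _ (rho ^+ k) (- (rho ^+ k.+1 * N.+1%:R^-1)) I0 I1) (IF N.+1) => /(_ _).
    rewrite rexp_lin// !rexp_exprn mulNr [X in _ - X]mulrAC; apply=> x x0.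
    rewrite /f sum_ffact_poisson.
    apply: le_trans (ler_wpM2l (exprn_ge0 k (y0 x x0)) (poisson_markov R _ N.+1 (y0 x x0) isT)).
    by rewrite le_eqVlt; apply/orP; left; apply/eqP; rewrite exprMn !exprS; ring.
  have := le_rexp _ _ _ (IF N.+1) (rexp_ableZ _ _ (rho ^+ k) I0) => /(_ _).
  rewrite rexpZ// rexp_exprn; apply=> x x0; rewrite /f sum_ffact_poisson -exprMn.
  by rewrite ler_piMr ?exprn_ge0 ?y0// sum_poisson_le1// y0.
- rewrite -[X in _ --> X]subr0; apply: cvgB; first exact: cvg_cst.
  rewrite -[X in _ --> X](mulr0 (rho ^+ k.+1 * rayleigh_moment R k.+1)).
  by apply: cvgMl_tmp; exact: cvg_harmonic.
- exact: cvg_cst.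
Qed.

Lemma mpo_scaled_momentE (rho c : R) s (a : nat -> R) : 0 < rho ->
  (forall x : nat, x%:R ^+ s = \sum_(k < s.+1) a k * (x ^_ k)%:R) ->
  mpo_scaled_moment rho c s =
  c^-1 ^+ s * \sum_(k < s.+1) a k * (rho ^+ k * rayleigh_moment R k).
Proof.
move=> r0 aE; apply: cvg_lim => //.
have L K : (fun N => \sum_(k < K) a k * \sum_(0 <= l < N) (l ^_ k)%:R * mpo_pmf rho l) @ \oo -->
    \sum_(k < K) a k * (rho ^+ k * rayleigh_moment R k).
  elim: K => [|K IH].
    by rewrite big_ord0; under eq_fun do rewrite big_ord0; exact: cvg_cst.
  rewrite big_ord_recr; under eq_fun do rewrite big_ord_recr /=.
  by apply: cvgD => //; apply: cvgMl_tmp; exact: mpo_ffact_cvg.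
have H : (fun N => c^-1 ^+ s * \sum_(k < s.+1) a k * \sum_(0 <= l < N) (l ^_ k)%:R * mpo_pmf rho l) @ \oo -->
    c^-1 ^+ s * \sum_(k < s.+1) a k * (rho ^+ k * rayleigh_moment R k) by apply: cvgMl_tmp.
apply: cvg_trans H; apply: near_eq_cvg; apply: nearW => N.
under eq_bigr do rewrite mulr_sumr.
rewrite exchange_big mulr_sumr /= big_mkord; apply: eq_bigr => l _.
rewrite exprMn aE !mulr_suml mulr_sumr; apply: eq_bigr => k _; ring.
Qed.

End Stirling.

(** * Limit theorems for the number of j-visits *)

Section Theorem6.
Variable R : realType.
Variable j : nat -> nat.
Hypothesis Hj : forall n, (0 < n)%N -> (1 <= j n <= n)%N.
Hypothesis j0 : (fun n => (j n)%:R / n%:R : R) @ \oo --> (0 : R).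

Let lam n := lambda R n (j n).
Let mom := @rayleigh_moment R.
Let X n (w : steps n) : R := (Xvis (j n) w)%:R.

Lemma lambda_gt0 n : (0 < n)%N -> 0 < lam n.
Proof.
move=> n0; have /andP[j1 jn] := Hj n n0.
rewrite /lam /lambda divr_gt0 ?mulr_gt0 ?exprn_gt0 ?sqrtr_gt0 ?ltr0n//.
by rewrite bin_gt0 -addnn leq_addl.
Qed.

Lemma lambda_ge0 n : 0 <= lam n.
Proof. by rewrite /lam /lambda divr_ge0 ?mulr_ge0 ?exprn_ge0. Qed.

Lemma ffact_moment_quotient_cvg s :
  (fun n => Ebridge (fun w : steps n => ((Xvis (j n) w) ^_ s)%:R : R) / lam n ^+ s) @ \oo --> mom s.
Proof. exact: ffact_moment_cvg (rayleigh_seq_moment R) Hj j0. Qed.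

Lemma ffact_moment_asymp s :
  exists eps : nat -> R, eps @ \oo --> (0 : R) /\
     \forall n \near \oo,
       Ebridge (fun w : steps n => ((Xvis (j n) w) ^_ s)%:R) =
       lam n ^+ s * (2 : R) `^ (s%:R / 2) * Gamma (s%:R / 2 + 1) * (1 + eps n).
Proof.
have m0 : 0 < mom s := rayleigh_seq_gt0 R _ (rayleigh_seq_moment R) s.
exists (fun n => (mom s)^-1 * (Ebridge (fun w : steps n => ((Xvis (j n) w) ^_ s)%:R) / lam n ^+ s) - 1).
split.
  rewrite -[X in _ --> X](subrr (1 : R)); apply: cvgB; last exact: cvg_cst.
  rewrite -{2}[1](mulVf (lt0r_neq0 m0)); apply: cvgMl_tmp; exact: ffact_moment_quotient_cvg.
exists 1%N => // n /= n0; have l0 := lambda_gt0 n n0.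
rewrite -[_ * Gamma _]mulrA Gamma_rayleigh -/(mom s) addrC subrK.
by field; rewrite expf_neq0 ?gt_eqF.
Qed.

Section Diverging.
Hypothesis lamy : lam @ \oo --> +oo.

Let xn n (w : steps n) : R := X n w / lam n.

Let xn_ge0 n w : 0 <= xn n w.
Proof. by rewrite /xn /X divr_ge0// lambda_ge0. Qed.

Let invlam0 : (fun n => (lam n)^-1) @ \oo --> (0 : R).
Proof.
have P : \forall n \near \oo, 0 < lam n by exists 1%N => // n /= n0; exact: lambda_gt0.
exact: ((gtr0_cvgV0 P).2 lamy).
Qed.

Lemma scaled_moment_cvg s : (fun n => Ebridge (fun w => xn n w ^+ s)) @ \oo --> mom s.
Proof.
have [a [as1 _ aE]] := exprn_ffact R s.
have := stirling_cvg R \oo a s _ _ mom as1 invlam0 ffact_moment_quotient_cvg.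
move=> /(_ _); apply: cvg_trans; apply: near_eq_cvg; exists 1%N => // n /= n0.
have l0 := lambda_gt0 n n0.
have -> : (fun w : steps n => xn n w ^+ s) = (fun w => \sum_(k < s.+1) (a k * (lam n)^-1 ^+ s) * ((Xvis (j n) w) ^_ k)%:R).
  apply/funext => w; rewrite /xn /X exprMn aE mulr_suml; apply: eq_bigr => k _; ring.
rewrite Ebridge_sum; apply: eq_bigr => k _; rewrite EbridgeZ -[RHS]mulrA; congr (_ * _).
have ks : (k <= s)%N by rewrite -ltnS.
rewrite -mulrA mulrC; congr (_ * _).
by rewrite -[in RHS](subnK ks) exprD !exprVn mulrC.
Qed.

Lemma scaled_poisson_cvg (N : R) l : 0 <= N ->
  (fun n => Ebridge (fun w => poisson R (N * xn n w) l)) @ \oo --> rexp R (fun x => poisson R (N * x) l).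
Proof.
move=> N0; rewrite poissonE rexpZ; last exact: rexp_able_exprn_exp.
have -> : (fun n => Ebridge (fun w => poisson R (N * xn n w) l)) =
   (fun n => N ^+ l / l`!%:R * Ebridge (fun w => xn n w ^+ l * expR (- (N * xn n w)))).
  apply/funext => n; rewrite -EbridgeZ; congr Ebridge; apply/funext => w.
  by rewrite /poisson exprMn; ring.
apply: cvgMl_tmp.
apply: (alternating_cvg R _ _ (fun n m => Ebridge (fun w => xn n w ^+ (l + m)%N))
  (fun m => mom (l + m)%N) (fun m => N ^+ m / m`!%:R)).
- move=> K; apply: nearW => n; rewrite -EbridgeZ.
  under eq_bigr do rewrite mulrA.
  apply: (Ebridge_approx _ _ K (fun m => (-1) ^+ m * (N ^+ m / m`!%:R)) _ _ (fun m w => xn n w ^+ (l + m)%N)).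
  move=> w; have x0 := xn_ge0 n w; move: (xn n w) x0 => x x0.
  rewrite (_ : _ - _ = x ^+ l * (expR (- (N * x)) - exp_taylor R K (N * x))).
    rewrite normrM (ger0_norm (exprn_ge0 _ x0)) exprD mulrCA ler_wpM2l ?exprn_ge0//.
    apply: le_trans (exp_taylor_err R K _ (mulr_ge0 N0 x0)) _.
    by rewrite exprMn mulrAC.
  rewrite mulrBr; congr (_ - _); rewrite /exp_taylor mulr_sumr; apply: eq_bigr => m _.
  by rewrite (exprNn (N * x)) exprMn exprD; ring.
- by move=> K; exact: rexp_taylor.
- by move=> m; exact: scaled_moment_cvg.
- exact: (rayleigh_seq_exp_cvg0 R mom N l (rayleigh_seq_moment R) N0).
Qed.

Lemma scaled_psmooth_cvg (N t : R) M : 0 <= N ->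
  (fun n => Ebridge (fun w => psmooth R N t M (xn n w))) @ \oo --> rexp R (psmooth R N t M).
Proof.
move=> N0; rewrite (rexp_sum _ _ _ _ (fun l x => poisson R (N * x) l)); last by move=> l; exact: rexp_able_poisson.
have -> : (fun n => Ebridge (fun w => psmooth R N t M (xn n w))) =
    (fun n => \sum_(0 <= l < M | l%:R / N <= t) Ebridge (fun w => poisson R (N * xn n w) l)).
  by apply/funext => n; rewrite -Ebridge_sum.
elim: (index_iota 0 M) => [|l r IH].
  by rewrite big_nil; under eq_fun do rewrite big_nil; exact: cvg_cst.
rewrite big_cons; under eq_fun do rewrite big_cons.
by case: ifP => // _; apply: cvgD => //; exact: scaled_poisson_cvg.
Qed.

Lemma scaled_cdf_cvg :
  cvg_distr \oo (fun n x => Pbridge R (fun w => xn n w <= x)) (@rayleigh_cdf R).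
Proof.
move=> t Ft; apply/cvgrPdist_le => e e0.
have e4 : 0 < e / 4 by rewrite divr_gt0.
have [d /= d0 Hd] : nbhs t (fun y => `|rayleigh_cdf t - rayleigh_cdf y| <= e / 4).
  by move/cvgrPdist_le: Ft; apply.
(* The kernel is used twice, for X / lambda and for the Rayleigh law, each time at the cost of a
   shift d'; the total 2 d' stays below d. *)
pose d' := d / 4.
have d'0 : 0 < d' by rewrite divr_gt0.
have F1 : `|rayleigh_cdf t - rayleigh_cdf (t - d' - d')| <= e / 4.
  apply: Hd => /=; rewrite (_ : t - _ = d' + d'); last by ring.
  by rewrite ger0_norm ?addr_ge0 ?ltW// /d'; lra.
have F2 : `|rayleigh_cdf t - rayleigh_cdf (t + d' + d')| <= e / 4.
  apply: Hd => /=; rewrite distrC (_ : t + d' + d' - t = d' + d'); last by ring.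
  by rewrite ger0_norm ?addr_ge0 ?ltW// /d'; lra.
have m0 : 0 < mom 1 := rayleigh_seq_gt0 R _ (rayleigh_seq_moment R) 1%N.
(* Chosen so that the Chebyshev error mu_1 / (N d'^2) equals e / 8. *)
pose N := 8 * (mom 1) / (e * d' ^+ 2).
have N0 : 0 < N by rewrite divr_gt0 ?mulr_gt0 ?exprn_gt0.
have NE : mom 1 / (N * d' ^+ 2) = e / 8.
  by rewrite /N; field; rewrite !gt_eqF.
pose M := (Num.truncn (N * (t + d'))).+1.
have M1 : N * (t + d') < M%:R by exact: truncnS_gt.
have M2 : N * (t - d') < M%:R.
  by apply: le_lt_trans M1; rewrite ler_pM2l//; lra.
have /andP[_ U] := rexp_psmooth_bounds R N (t + d') d' M N0 d'0 M1.
have /andP[L _] := rexp_psmooth_bounds R N (t - d') d' M N0 d'0 M2.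
rewrite -/(mom 1) NE in U; rewrite -/(mom 1) NE in L.
have C1 := scaled_psmooth_cvg N (t + d') M (ltW N0).
have C2 := scaled_psmooth_cvg N (t - d') M (ltW N0).
have C3 : (fun n => (N * d' ^+ 2)^-1 * Ebridge (fun w => xn n w ^+ 1)) @ \oo --> (N * d' ^+ 2)^-1 * mom 1.
  by apply: cvgMl_tmp; exact: scaled_moment_cvg.
rewrite (mulrC _ (mom 1)) NE in C3.
near=> n.
have H1 : `|rexp R (psmooth R N (t + d') M) - Ebridge (fun w => psmooth R N (t + d') M (xn n w))| <= e / 8.
  by near: n; move/cvgrPdist_le: C1; apply; rewrite divr_gt0.
have H2 : `|rexp R (psmooth R N (t - d') M) - Ebridge (fun w => psmooth R N (t - d') M (xn n w))| <= e / 8.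
  by near: n; move/cvgrPdist_le: C2; apply; rewrite divr_gt0.
have H3 : `|e / 8 - (N * d' ^+ 2)^-1 * Ebridge (fun w => xn n w ^+ 1)| <= e / 8.
  by near: n; move/cvgrPdist_le: C3; apply; rewrite divr_gt0.
have P1 : Pbridge R (fun w => xn n w <= t) <= Ebridge (fun w => psmooth R N (t + d') M (xn n w)) +
    (N * d' ^+ 2)^-1 * Ebridge (fun w => xn n w ^+ 1).
  rewrite -EbridgeZ -EbridgeD; apply: Ebridge_le => w.
  have := psmooth_ge R N (t + d') d' (xn n w) M N0 d'0 (xn_ge0 n w) M1.
  by rewrite addrK expr1 mulrC; lra.
have P2 : Ebridge (fun w => psmooth R N (t - d') M (xn n w)) <=
    Pbridge R (fun w => xn n w <= t) + (N * d' ^+ 2)^-1 * Ebridge (fun w => xn n w ^+ 1).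
  rewrite -EbridgeZ -EbridgeD; apply: Ebridge_le => w.
  have := psmooth_le R N (t - d') d' (xn n w) M N0 d'0 (xn_ge0 n w).
  by rewrite subrK expr1 mulrC; lra.
move: (F1) (F2) (H1) (H2) (H3) (P1) (P2) (U) (L); rewrite !ler_norml.
move=> /andP[? ?] /andP[? ?] /andP[? ?] /andP[? ?] /andP[? ?] ? ? ? ?.
by apply/andP; split; lra.
Unshelve. all: by end_near. Qed.

End Diverging.

Section Converging.
Variable rho : R.
Hypothesis rho0 : 0 < rho.
Hypothesis lamr : lam @ \oo --> rho.

Lemma ffact_moment_limit s :
  (fun n => Ebridge (fun w : steps n => ((Xvis (j n) w) ^_ s)%:R : R)) @ \oo --> rho ^+ s * mom s.
Proof.
have L : (fun n => lam n ^+ s * (Ebridge (fun w : steps n => ((Xvis (j n) w) ^_ s)%:R : R) / lam n ^+ s)) @ \oo --> rho ^+ s * mom s.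
  apply: cvgM; last exact: ffact_moment_quotient_cvg.
  exact: (cvg_comp lam (fun y : R => y ^+ s) lamr (@exprn_continuous R s rho)).
apply: cvg_trans L; apply: near_eq_cvg; exists 1%N => // n /= n0.
by rewrite mulrC divfK// expf_neq0// gt_eqF// lambda_gt0.
Qed.

Lemma moment_limit s :
  (fun n => Ebridge (fun w : steps n => X n w ^+ s)) @ \oo --> mpo_scaled_moment rho 1 s.
Proof.
have [a [as1 _ aE]] := exprn_ffact R s.
rewrite (mpo_scaled_momentE R rho 1 s a rho0 aE) invr1 expr1n mul1r.
have -> : (fun n => Ebridge (fun w : steps n => X n w ^+ s)) =
    (fun n => \sum_(k < s.+1) a k * Ebridge (fun w : steps n => ((Xvis (j n) w) ^_ k)%:R : R)).
  apply/funext => n.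
  have -> : (fun w : steps n => X n w ^+ s) = (fun w => \sum_(k < s.+1) a k * ((Xvis (j n) w) ^_ k)%:R).
    by apply/funext => w; rewrite /X aE.
  by rewrite Ebridge_sum; apply: eq_bigr => k _; rewrite EbridgeZ.
elim: s.+1 => [|K IH].
  by rewrite big_ord0; under eq_fun do rewrite big_ord0; exact: cvg_cst.
rewrite big_ord_recr; under eq_fun do rewrite big_ord_recr /=.
by apply: cvgD => //; apply: cvgMl_tmp; exact: ffact_moment_limit.
Qed.

Lemma pmf_limit l :
  (fun n => Pbridge R (fun w : steps n => Xvis (j n) w == l)) @ \oo --> mpo_pmf rho l.
Proof.
have l0 : l`!%:R != 0 :> R by rewrite pnatr_eq0 -lt0n fact_gt0.
have c0 : 0 <= rho ^+ l / l`!%:R by rewrite divr_ge0// exprn_ge0// ltW.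
(* The factorial moments are divided by l! rho^m so that both expansions carry the common weight
   rho^m / m!. *)
apply: (alternating_cvg R _ _
  (fun n m => (l`!%:R * rho ^+ m)^-1 * Ebridge (fun w : steps n => ((Xvis (j n) w) ^_ (l + m))%:R : R))
  (fun m => rho ^+ l / l`!%:R * mom (l + m)%N) (fun m => rho ^+ m / m`!%:R)).
- move=> K; apply: nearW => n.
  have wE m : rho ^+ m / m`!%:R * ((l`!%:R * rho ^+ m)^-1 * Ebridge (fun w : steps n => ((Xvis (j n) w) ^_ (l + m))%:R : R))
      = Ebridge (fun w : steps n => ((Xvis (j n) w) ^_ (l + m))%:R / (l`!%:R * m`!%:R) : R).
    have m0 : m`!%:R != 0 :> R by rewrite pnatr_eq0 -lt0n fact_gt0.
    have -> : Ebridge (fun w : steps n => ((Xvis (j n) w) ^_ (l + m))%:R / (l`!%:R * m`!%:R) : R)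
       = (l`!%:R * m`!%:R)^-1 * Ebridge (fun w : steps n => ((Xvis (j n) w) ^_ (l + m))%:R : R).
      by rewrite -EbridgeZ; congr Ebridge; apply/funext => w; rewrite mulrC.
    by field; rewrite l0 m0 expf_neq0// gt_eqF.
  rewrite wE; under eq_bigr do rewrite wE.
  apply: (Ebridge_approx _ _ K (fun m => (-1) ^+ m) _ _ (fun m w => ((Xvis (j n) w) ^_ (l + m))%:R / (l`!%:R * m`!%:R))).
  by move=> w; exact: bonferroni.
- move=> K; rewrite /mpo_pmf -/(rexp R (fun x => x ^+ l * expR (- (rho * x)))).
  rewrite [leRHS]mulrCA.
  have -> : \sum_(m < K) (-1) ^+ m * (rho ^+ m / m`!%:R * (rho ^+ l / l`!%:R * mom (l + m)%N)) =
     rho ^+ l / l`!%:R * \sum_(m < K) (-1) ^+ m * (rho ^+ m / m`!%:R * mom (l + m)%N).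
    by rewrite mulr_sumr; apply: eq_bigr => m _; ring.
  rewrite -mulrBr normrM (ger0_norm c0) ler_wpM2l//.
  exact: rexp_taylor (ltW rho0).
- move=> m.
  have -> : rho ^+ l / l`!%:R * mom (l + m) = (l`!%:R * rho ^+ m)^-1 * (rho ^+ (l + m) * mom (l + m)%N).
    by rewrite exprD; field; rewrite l0 expf_neq0// gt_eqF.
  by apply: cvgMl_tmp; exact: ffact_moment_limit.
- have L := rayleigh_seq_exp_cvg0 R mom rho l (rayleigh_seq_moment R) (ltW rho0).
  have {}L : (fun K => rho ^+ l / l`!%:R * (rho ^+ K / K`!%:R * mom (l + K)%N)) @ \oo --> rho ^+ l / l`!%:R * 0.
    by apply: cvgMl_tmp.
  rewrite mulr0 in L; apply: cvg_trans L; apply: near_eq_cvg; apply: nearW => K; exact: mulrCA.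
Qed.

(** For integer values the distribution function at t is a finite sum of point probabilities, so
    convergence holds at every t, jumps included. *)
Lemma cdf_limit (t : R) :
  (fun n => Pbridge R (fun w : steps n => X n w <= t)) @ \oo --> mpo_scaled_cdf rho 1 t.
Proof.
have M1 : 1 * t < (Num.truncn t).+1%:R by rewrite mul1r truncnS_gt.
rewrite (mpo_scaled_cdfE R rho 1 t _ ltr01 M1).
set M := (Num.truncn t).+1 in M1 *.
have -> : (fun n => Pbridge R (fun w : steps n => X n w <= t)) =
   (fun n => \sum_(0 <= l < M | l%:R / 1 <= t) Pbridge R (fun w : steps n => Xvis (j n) w == l)).
  apply/funext => n; rewrite /Pbridge -Ebridge_sum; congr Ebridge; apply/funext => w.
  rewrite /X; move: (Xvis _ _) => x.
  have [xt|tx] := leP (x%:R : R) t; last first.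
    rewrite big1// => l; rewrite divr1 => lt; case: eqP => // xl.
    by move: tx; rewrite xl ltNge lt.
  have xM : (x < M)%N by rewrite -(ltr_nat R); apply: le_lt_trans xt _; rewrite mul1r in M1.
  rewrite big_mkcond /= (@big_cat_nat _ _ _ x) //=; last exact: ltnW.
  rewrite big_nat big1 ?add0r; last first.
    by move=> l /andP[_ lx]; rewrite gtn_eqF//; case: ifP.
  rewrite big_ltn// divr1 xt eqxx big_nat big1 ?addr0// => l /andP[xl _].
  by rewrite ltn_eqF//; case: ifP.
elim: (index_iota 0 M) => [|l r IH].
  by rewrite big_nil; under eq_fun do rewrite big_nil; exact: cvg_cst.
rewrite big_cons; under eq_fun do rewrite big_cons.
by case: ifP => // _; apply: cvgD => //; exact: pmf_limit.
Qed.

End Converging.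

End Theorem6.

(** * Mixed Poisson laws with large parameter *)

Lemma mpo_scaled_cdf_cvg (R : realType) :
  cvg_distr (+oo%R : set_system R) (fun rho x => mpo_scaled_cdf rho rho x) (@rayleigh_cdf R).
Proof.
move=> t Ft; apply/cvgrPdist_le => e e0.
have e2 : 0 < e / 2 by rewrite divr_gt0.
have [d /= d0 Hd] : nbhs t (fun y => `|rayleigh_cdf t - rayleigh_cdf y| <= e / 2).
  by move/cvgrPdist_le: Ft; apply.
(* Here Y / rho is itself the smoothed law, so a single shift is incurred. *)
pose d' := d / 2.
have d'0 : 0 < d' by rewrite divr_gt0.
have F1 : `|rayleigh_cdf t - rayleigh_cdf (t - d')| <= e / 2.
  apply: Hd => /=; rewrite (_ : t - _ = d'); last by ring.
  by rewrite ger0_norm ?ltW// /d'; lra.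
have F2 : `|rayleigh_cdf t - rayleigh_cdf (t + d')| <= e / 2.
  apply: Hd => /=; rewrite distrC (_ : t + d' - t = d'); last by ring.
  by rewrite ger0_norm ?ltW// /d'; lra.
have m0 : 0 < rayleigh_moment R 1 := rayleigh_seq_gt0 R _ (rayleigh_seq_moment R) 1%N.
near=> N.
have N0 : 0 < N by near: N; exact: (nbhs_pinfty_gt (num_real _)).
have NE : rayleigh_moment R 1 / (N * d' ^+ 2) <= e / 2.
  by rewrite invfM mulrCA ler_pdivrMl// (mulrC N) -ler_pdivrMl.
have M1 : N * t < (Num.truncn (N * t)).+1%:R by exact: truncnS_gt.
have := rexp_psmooth_bounds R N t d' _ N0 d'0 M1.
rewrite (mpo_scaled_cdfE R N N t _ N0 M1) -(rexp_psmooth R N t _ (ltW N0)) => /andP[L U].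
move: (F1) (F2) (NE) (L) (U); rewrite !ler_norml.
move=> /andP[? ?] /andP[? ?] ? ? ?.
by apply/andP; split; lra.
Unshelve. all: by end_near. Qed.

Lemma mpo_scaled_moment_cvg (R : realType) s :
  (fun rho => mpo_scaled_moment rho rho s) @ +oo%R --> rayleigh_moment R s.
Proof.
have [a [as1 _ aE]] := exprn_ffact R s.
have I0 : (fun rho : R => rho^-1) @ +oo%R --> (0 : R).
  have P : \forall x \near (+oo%R : set_system R), 0 < x by exact: (nbhs_pinfty_gt (num_real _)).
  exact: ((gtr0_cvgV0 P).2 cvg_id).
have L : (fun rho : R => \sum_(k < s.+1) a k * (rayleigh_moment R k * rho^-1 ^+ (s - k))) @ +oo%R -->
    rayleigh_moment R s.
  apply: (stirling_cvg R _ a s (fun rho : R => rho^-1) (fun k _ => rayleigh_moment R k)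
    (@rayleigh_moment R)) => // k.
  exact: cvg_cst.
move: L; apply: cvg_trans; apply: near_eq_cvg; near=> rho.
have r0 : 0 < rho by near: rho; exact: (nbhs_pinfty_gt (num_real _)).
rewrite (mpo_scaled_momentE R rho rho s a r0 aE) mulr_sumr; apply: eq_bigr => k _.
have ks : (k <= s)%N by rewrite -ltnS.
have -> : rho^-1 ^+ s = rho^-1 ^+ (s - k) * rho^-1 ^+ k by rewrite -exprD subnK.
rewrite !exprVn; by field; rewrite !expf_neq0 ?gt_eqF.
Unshelve. all: by end_near. Qed.

Theorem theorem6 (R : realType) :
  (* asymptotics of factorial moments *)
  (forall j : nat -> nat,
     (forall n, (0 < n)%N -> (1 <= j n <= n)%N) ->
     (fun n => (j n)%:R / n%:R : R) @ \oo --> (0 : R) ->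
     forall s : nat, (1 <= s)%N ->
     exists eps : nat -> R, eps @ \oo --> (0 : R) /\
       \forall n \near \oo,
         Ebridge (fun w : steps n => ((Xvis (j n) w) ^_ s)%:R) =
         lambda R n (j n) ^+ s * (2 : R) `^ (s%:R / 2)
           * Gamma (s%:R / 2 + 1) * (1 + eps n))
  /\
  (* (i) *)
  (forall j : nat -> nat,
     (forall n, (0 < n)%N -> (1 <= j n <= n)%N) ->
     (fun n => (j n)%:R / n%:R : R) @ \oo --> (0 : R) ->
     (fun n => lambda R n (j n)) @ \oo --> +oo%R ->
     cvg_distr \oo
       (fun n x => Pbridge R (fun w : steps n =>
                     (Xvis (j n) w)%:R / lambda R n (j n) <= x))
       (@rayleigh_cdf R)
     /\ forall s : nat,
       (fun n => Ebridge (fun w : steps n =>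
                   ((Xvis (j n) w)%:R / lambda R n (j n)) ^+ s))
         @ \oo --> rayleigh_moment R s)
  /\
  (* (ii) *)
  (forall j : nat -> nat,
     (forall n, (0 < n)%N -> (1 <= j n <= n)%N) ->
     (fun n => (j n)%:R / n%:R : R) @ \oo --> (0 : R) ->
     forall rho : R, 0 < rho ->
     (fun n => lambda R n (j n)) @ \oo --> rho ->
     cvg_distr \oo
       (fun n x => Pbridge R (fun w : steps n => (Xvis (j n) w)%:R <= x))
       (mpo_scaled_cdf rho 1)
     /\ forall s : nat,
       (fun n => Ebridge (fun w : steps n => ((Xvis (j n) w)%:R) ^+ s))
         @ \oo --> mpo_scaled_moment rho 1 s)
  /\
  (* Y / rho -> X as rho -> oo *)
  (cvg_distr (+oo%R : set_system R) (fun rho x => mpo_scaled_cdf rho rho x)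
     (@rayleigh_cdf R)
   /\ forall s : nat,
     (fun rho => mpo_scaled_moment rho rho s) @ +oo%R --> rayleigh_moment R s).
Proof.
split; first by move=> j Hj j0 s _; exact: ffact_moment_asymp.
split.
  move=> j Hj j0 ly; split; first exact: scaled_cdf_cvg.
  by move=> s; exact: scaled_moment_cvg.
split.
  move=> j Hj j0 rho r0 lr; split; first by move=> t _; exact: cdf_limit.
  by move=> s; exact: moment_limit.
split; first exact: mpo_scaled_cdf_cvg.
exact: mpo_scaled_moment_cvg.
Qed.
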